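(* Let $N$ be a connected and simply connected $2$-step nilpotent Lie group of dimension $\leq 7$ endowed with a left-invariant Riemannian metric. Then every left-invariant symmetric Killing $2$-tensor on $N$ is decomposable.
   Context: A $2$-step nilpotent Lie group is one whose Lie algebra $\mathfrak n$ is non-abelian with $[[\mathfrak n,\mathfrak n],\mathfrak n]=0$. A symmetric $2$-tensor field $S$ on a Riemannian manifold with Levi-Civita connection $\nabla$ is a Killing tensor if $(\nabla_XS)(X,X)=0$ for every vector field $X$. A left-invariant symmetric Killing $2$-tensor on $N$ is called decomposable if it is the sum of a parallel symmetric $2$-tensor field and a (real, finite) linear combination of symmetric products $\xi\cdot\eta=\xi\otimes\eta+\eta\otimes\xi$ of Killing vector fields $\xi,\eta$ on $N$ (not necessarily left-invariant; vectors are identified with covectors via the metric). *)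

(* Defs.v *)
From HB Require Import structures.
From mathcomp Require Import all_boot all_order all_algebra.
From mathcomp Require Import all_classical all_reals all_analysis.
Set Implicit Arguments.
Unset Strict Implicit.
Unset Printing Implicit Defensive.
Import Order.TTheory GRing.Theory Num.Theory.
Import numFieldNormedType.Exports.
Local Open Scope classical_set_scope.
Local Open Scope ring_scope.

Section Smooth.
Context {R : realType} {V W : normedModType R}.

Fixpoint Ck_on (k : nat) (U : set V) (f : V -> W) : Prop :=
  if k is k'.+1 then
    (forall x, U x -> differentiable f x) /\ (forall v, Ck_on k' U ('D_v f))
  else forall x, U x -> {for x, continuous f}.

Definition smooth_on (U : set V) (f : V -> W) : Prop :=
  forall k, Ck_on k U f.

End Smooth.

(* An atlas on [M] in which every point [p] comes with a preferred chart
   [chart_at p] around it.  [chart i] and [chart_inv i] are total functions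
   but are meaningful only on [dom i] and on its image [chart i @` dom i]. *)
Record smooth_manifold (R : realType) (n : nat) (M : topologicalType) := {
  chart_index : Type;
  dom : chart_index -> set M;
  chart : chart_index -> M -> 'rV[R]_n;
  chart_inv : chart_index -> 'rV[R]_n -> M;
  chart_at : M -> chart_index;
  mfd_hausdorff : hausdorff_space M;
  mfd_second_countable : @second_countable M;
  chart_at_dom : forall p, dom (chart_at p) p;
  dom_open : forall i, open (dom i);
  img_open : forall i, open (chart i @` dom i);
  chartK : forall i p, dom i p -> chart_inv i (chart i p) = p;
  chart_continuous :
    forall i p, dom i p -> {for p, continuous (chart i)};
  chart_inv_continuous :
    forall i y, (chart i @` dom i) y -> {for y, continuous (chart_inv i)};
  transition_smooth : forall i j,
    smooth_on (chart i @` (dom i `&` dom j)) (chart j \o chart_inv i)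
}.
Arguments dom {R n M} A i _ : rename.
Arguments chart {R n M} A i _ : rename.
Arguments chart_inv {R n M} A i _ : rename.
Arguments chart_at {R n M} A p : rename.

(* The tangent space at [p] is 'rV[R]_n: a tangent vector is given by its
   coordinates in the preferred chart at [p].  Vector fields are therefore
   functions M -> 'rV[R]_n and 2-tensor fields functions M -> 'M[R]_n. *)
Section Manifold.
Context {R : realType} {n : nat} {M : topologicalType}.
Variable A : smooth_manifold R n M.

Definition pt_coord (p : M) : 'rV[R]_n := chart A (chart_at A p) p.
Definition loc (p : M) : 'rV[R]_n -> M := chart_inv A (chart_at A p).

(* The derivative v(f) of f along the tangent vector v at p. *)
Definition dfun (f : M -> R) (p : M) (v : 'rV[R]_n) : R :=
  'd (f \o loc p) (pt_coord p) v.

Definition tangent_map (F : M -> M) (p : M) (v : 'rV[R]_n) : 'rV[R]_n :=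
  'd (chart A (chart_at A (F p)) \o F \o loc p) (pt_coord p) v.

(* From coordinates in the preferred chart at [p] to coordinates in the chart
   [i], and back; [p] is meant to lie in [dom A i]. *)
Definition to_chart (i : chart_index A) (p : M) (v : 'rV[R]_n) : 'rV[R]_n :=
  'd (chart A i \o loc p) (pt_coord p) v.
Definition of_chart (i : chart_index A) (p : M) (w : 'rV[R]_n) : 'rV[R]_n :=
  'd (chart A (chart_at A p) \o chart_inv A i) (chart A i p) w.

Definition smooth_fun (f : M -> R) : Prop :=
  forall i, smooth_on (chart A i @` dom A i) (f \o chart_inv A i).

Definition smooth_map (F : M -> M) : Prop :=
  continuous F /\
  forall i j,
    smooth_on (chart A i @` (dom A i `&` F @^-1` dom A j))
      (chart A j \o F \o chart_inv A i).

Definition smooth_map2 (F : M -> M -> M) : Prop :=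
  continuous (fun pq : M * M => F pq.1 pq.2) /\
  forall i j k,
    smooth_on
      [set (chart A i pq.1, chart A j pq.2) | pq in
         [set pq : M * M | dom A i pq.1 /\ dom A j pq.2 /\
                           dom A k (F pq.1 pq.2)]]
      (fun xy : 'rV[R]_n * 'rV[R]_n =>
         chart A k (F (chart_inv A i xy.1) (chart_inv A j xy.2))).

Definition vfield_coord (X : M -> 'rV[R]_n) (i : chart_index A)
    (y : 'rV[R]_n) : 'rV[R]_n :=
  to_chart i (chart_inv A i y) (X (chart_inv A i y)).

Definition smooth_vfield (X : M -> 'rV[R]_n) : Prop :=
  forall i, smooth_on (chart A i @` dom A i) (vfield_coord X i).

Definition lie_bracket (X Y : M -> 'rV[R]_n) (p : M) : 'rV[R]_n :=
  'd (vfield_coord Y (chart_at A p)) (pt_coord p) (X p)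
  - 'd (vfield_coord X (chart_at A p)) (pt_coord p) (Y p).

Definition tensor_app (S : M -> 'M[R]_n) (p : M) (u v : 'rV[R]_n) : R :=
  (u *m S p *m v^T) 0 0.

Definition smooth_tensor (S : M -> 'M[R]_n) : Prop :=
  forall i u v,
    smooth_on (chart A i @` dom A i)
      (fun y => let p := chart_inv A i y in
                tensor_app S p (of_chart i p u) (of_chart i p v)).

Definition sym_tensor_field (S : M -> 'M[R]_n) : Prop :=
  smooth_tensor S /\ forall p, (S p)^T = S p.

Definition riemannian_metric (g : M -> 'M[R]_n) : Prop :=
  sym_tensor_field g /\
  forall p v, v != 0 -> 0 < tensor_app g p v v.

(* [nabla] is constrained only on smooth vector fields, where these conditions
   determine it. *)
Definition levi_civita (g : M -> 'M[R]_n)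
    (nabla : (M -> 'rV[R]_n) -> (M -> 'rV[R]_n) -> M -> 'rV[R]_n) : Prop :=
  (forall X Y, smooth_vfield X -> smooth_vfield Y ->
     smooth_vfield (nabla X Y)) /\
  (forall X X' Y p, smooth_vfield X -> smooth_vfield X' -> smooth_vfield Y ->
     nabla (fun q => X q + X' q) Y p = nabla X Y p + nabla X' Y p) /\
  (forall f X Y p, smooth_fun f -> smooth_vfield X -> smooth_vfield Y ->
     nabla (fun q => f q *: X q) Y p = f p *: nabla X Y p) /\
  (forall X Y Y' p, smooth_vfield X -> smooth_vfield Y -> smooth_vfield Y' ->
     nabla X (fun q => Y q + Y' q) p = nabla X Y p + nabla X Y' p) /\
  (forall f X Y p, smooth_fun f -> smooth_vfield X -> smooth_vfield Y ->
     nabla X (fun q => f q *: Y q) p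
     = dfun f p (X p) *: Y p + f p *: nabla X Y p) /\
  (forall X Y p, smooth_vfield X -> smooth_vfield Y ->
     nabla X Y p - nabla Y X p = lie_bracket X Y p) /\
  (forall X Y Z p, smooth_vfield X -> smooth_vfield Y -> smooth_vfield Z ->
     dfun (fun q => tensor_app g q (Y q) (Z q)) p (X p)
     = tensor_app g p (nabla X Y p) (Z p)
       + tensor_app g p (Y p) (nabla X Z p)).

(* (nabla_X S)(Y, Z) at p *)
Definition cov_tensor
    (nabla : (M -> 'rV[R]_n) -> (M -> 'rV[R]_n) -> M -> 'rV[R]_n)
    (S : M -> 'M[R]_n) (X Y Z : M -> 'rV[R]_n) (p : M) : R :=
  dfun (fun q => tensor_app S q (Y q) (Z q)) p (X p)
  - tensor_app S p (nabla X Y p) (Z p)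
  - tensor_app S p (Y p) (nabla X Z p).

Definition killing_tensor
    (nabla : (M -> 'rV[R]_n) -> (M -> 'rV[R]_n) -> M -> 'rV[R]_n)
    (S : M -> 'M[R]_n) : Prop :=
  sym_tensor_field S /\
  forall X, smooth_vfield X -> forall p, cov_tensor nabla S X X X p = 0.

Definition parallel_tensor
    (nabla : (M -> 'rV[R]_n) -> (M -> 'rV[R]_n) -> M -> 'rV[R]_n)
    (S : M -> 'M[R]_n) : Prop :=
  sym_tensor_field S /\
  forall X Y Z, smooth_vfield X -> smooth_vfield Y -> smooth_vfield Z ->
    forall p, cov_tensor nabla S X Y Z p = 0.

(* L_xi g = 0, evaluated on (X, Y). *)
Definition killing_vfield (g : M -> 'M[R]_n) (xi : M -> 'rV[R]_n) : Prop :=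
  smooth_vfield xi /\
  forall X Y, smooth_vfield X -> smooth_vfield Y -> forall p,
    dfun (fun q => tensor_app g q (X q) (Y q)) p (xi p)
    = tensor_app g p (lie_bracket xi X p) (Y p)
      + tensor_app g p (X p) (lie_bracket xi Y p).

Definition flat (g : M -> 'M[R]_n) (X : M -> 'rV[R]_n) (p : M) : 'rV[R]_n :=
  X p *m g p.

(* xi (x) eta + eta (x) xi, vectors being identified with covectors by g *)
Definition sym_product (g : M -> 'M[R]_n) (xi eta : M -> 'rV[R]_n)
    (p : M) : 'M[R]_n :=
  (flat g xi p)^T *m flat g eta p + (flat g eta p)^T *m flat g xi p.

Definition decomposable (g : M -> 'M[R]_n)
    (nabla : (M -> 'rV[R]_n) -> (M -> 'rV[R]_n) -> M -> 'rV[R]_n)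
    (S : M -> 'M[R]_n) : Prop :=
  exists (T : M -> 'M[R]_n) (m : nat) (c : 'I_m -> R)
         (xi eta : 'I_m -> M -> 'rV[R]_n),
    parallel_tensor nabla T /\
    (forall k, killing_vfield g (xi k)) /\
    (forall k, killing_vfield g (eta k)) /\
    (forall p, S p = T p + \sum_(k < m) c k *: sym_product g (xi k) (eta k) p).

End Manifold.

(* Every loop is homotopic to a constant one relatively to its base point;
   path-connectedness is not included. *)
Definition loops_contractible (R : realType) (M : topologicalType) : Prop :=
  forall gamma : R -> M,
    {within `[0, 1], continuous gamma} -> gamma 0 = gamma 1 ->
    exists H : R * R -> M,
      {within `[0, 1] `*` `[0, 1], continuous H} /\
      (forall t : R, 0 <= t <= 1 -> H (t, 0) = gamma t) /\
      (forall t : R, 0 <= t <= 1 -> H (t, 1) = gamma 0) /\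
      (forall s : R, 0 <= s <= 1 -> H (0, s) = gamma 0 /\ H (1, s) = gamma 0).

Record lie_group (R : realType) (n : nat) (N : topologicalType) := {
  lg_mfd :> smooth_manifold R n N;
  lg_mul : N -> N -> N;
  lg_inv : N -> N;
  lg_one : N;
  lg_mulA : associative lg_mul;
  lg_mul1 : left_id lg_one lg_mul;
  lg_mulV : left_inverse lg_one lg_inv lg_mul;
  lg_mul_smooth : smooth_map2 lg_mfd lg_mul;
  lg_inv_smooth : smooth_map lg_mfd lg_inv
}.

Section LieGroup.
Context {R : realType} {n : nat} {N : topologicalType}.
Variable G : lie_group R n N.

(* The Lie algebra of G consists of these fields, with [lie_bracket]. *)
Definition left_invariant_vfield (X : N -> 'rV[R]_n) : Prop :=
  smooth_vfield G X /\
  forall a p, X (lg_mul G a p) = tangent_map G (lg_mul G a) p (X p).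

Definition left_invariant_tensor (S : N -> 'M[R]_n) : Prop :=
  forall a p u v,
    tensor_app S (lg_mul G a p) (tangent_map G (lg_mul G a) p u)
                                (tangent_map G (lg_mul G a) p v)
    = tensor_app S p u v.

(* The Lie algebra is not abelian; as [[n, n], n] is spanned by the iterated
   brackets, it vanishes if and only if they all do. *)
Definition two_step_nilpotent : Prop :=
  (exists X Y, left_invariant_vfield X /\ left_invariant_vfield Y /\
     exists p, lie_bracket G X Y p != 0) /\
  (forall X Y Z, left_invariant_vfield X -> left_invariant_vfield Y ->
     left_invariant_vfield Z ->
     forall p, lie_bracket G (lie_bracket G X Y) Z p = 0).

End LieGroup.

(* Main.v *)
(* Write the Lie algebra as v + z with z its centre and j(z) : v -> v the skew maps
   dual to the bracket. A left-invariant symmetric S is Killing iff its v-part A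
   commutes with all j(z) and j(z) S z = 0 on the centre. The metric is parallel and
   central fields are Killing, so only A - l and the mixed part of S matter, for a
   scalar l of our choice. If dim z <= 1 the j(z) commute; otherwise dim v <= 5, at most
   one eigenspace of A has dimension > 2, and the j(z) commute on the others: in both
   cases B = A - l satisfies B j(z) j(z') = B j(z') j(z). Then each B j(z) is a skew
   derivation and, for f : N -> v with differential the projection to v,
     B = sum B_ij xi_i (x) xi_j + sum z_k . rot(B j(z_k)),
   with xi_i = e_i - [f, e_i] right-invariant and rot(D) = f D - [f, f D] / 2 Killing.
   The mixed part is a combination of products of central and right-invariant
   fields. *)
Require Import Defs.
From HB Require Import structures.
From mathcomp Require Import all_boot all_order all_algebra.
From mathcomp Require Import complex.
From mathcomp Require Import all_classical all_reals all_analysis.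
From mathcomp Require Import ring lra.
Set Implicit Arguments.
Unset Strict Implicit.
Unset Printing Implicit Defensive.
Import Order.TTheory GRing.Theory Num.Theory.
Import numFieldNormedType.Exports.
Local Open Scope classical_set_scope.
Local Open Scope ring_scope.

(** * Linear algebra *)

(** A skew map D that vanishes on the centre is a derivation exactly when it commutes with every
    j(z), since [Dx, y] + [x, Dy] = 0 paired with z says D j(z) = j(z) D. For D = B j(z), with B
    symmetric and commuting with the j's, skewness is automatic and being a derivation is the
    identity B j(z) j(z') = B j(z') j(z). This is the only place where the dimension enters:
    subtracting a scalar l removes a single eigenspace of A, so every other eigenspace has to be at
    most a plane, where skew maps commute. The geometry is turned into matrices as follows. In a
    left-invariant orthonormal frame, S and the bracket have constant entries, and every Killing
    field used has components that are polynomials of degree at most 2 in f. Being Killing is then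
    an identity between matrices depending on f, and the decomposition is an identity whose left
    side is constant although each product on the right varies with f. *)

Lemma symmetric_diagonalizable (R : rcfType) n (A : 'M[R]_n) :
  A^T = A -> diagonalizable A.
Proof.
case: n A => [|n] A symA; first by rewrite [A]flatmx0; exact: diagonalizable0.
(* Over [R[i]] the matrix is Hermitian, hence unitarily diagonal with real eigenvalues. The minimal
   polynomial does not change under the field extension, so it divides a product of distinct real
   linear factors. *)
pose AC : 'M[R[i]]_n.+1 := map_mx (real_complex R) A.
have AC_herm : AC \is hermsymmx.
  apply: realsym_hermsym.
    apply/is_hermitianmxP; rewrite expr0 scale1r map_mx_id // map_trmx symA //.
  by apply/mxOverP => i j; rewrite mxE; apply/complex_realP; exists (A i j).
have /orthomx_spectralP := hermitian_normalmx AC_herm.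
have := hermitian_spectral_diag_real AC_herm.
set P := spectralmx AC; set d := spectral_diag AC => d_real AC_eq.
apply/diagonalizableP.
pose rs := undup [seq complex.Re (d 0 i) | i <- enum 'I_n.+1].
exists rs; first exact: undup_uniq.
rewrite -(dvdp_map (real_complex R)) -mxminpoly_map -/AC AC_eq.
rewrite -conjVmx ?spectral_unit// mxminpoly_uconj ?unitmx_inv ?spectral_unit//.
rewrite mxminpoly_diag rmorph_prod /=.
rewrite [X in _ %| X](eq_bigr (fun r => 'X - (r%:C)%C%:P)); last first.
  by move=> r _; rewrite rmorphB /= map_polyX map_polyC.
rewrite -(big_map (real_complex R) predT (fun r => 'X - r%:P)) /=.
rewrite -undup_map_inj; last exact: complexI.

rewrite [in X in _ %| X](_ : map _ _ = [seq d 0 i | i <- enum 'I_n.+1]) ?dvdpp //.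
rewrite -map_comp; apply: eq_map => i /=.
by have /mxOverP/(_ 0 i)/Creal_ReP := d_real; rewrite -complexRe.
Qed.

Definition posdef (R : realFieldType) n (K : 'M[R]_n) :=
  forall v : 'rV[R]_n, v != 0 -> 0 < (v *m K *m v^T) 0 0.

Lemma dot_gt0 (R : realFieldType) n (v : 'rV[R]_n) :
  v != 0 -> 0 < (v *m v^T) 0 0.
Proof.
move=> vn0; rewrite mxE lt0r sumr_ge0 ?andbT => [|i _]; last first.
  by rewrite mxE -expr2 sqr_ge0.
apply: contra vn0; rewrite psumr_eq0 => [|i _]; last first.
  by rewrite mxE -expr2 sqr_ge0.
move=> /allP v0; apply/eqP/rowP => i; rewrite mxE.
by have := v0 i (mem_index_enum i); rewrite /= mxE mulf_eq0 orbb => /eqP.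
Qed.

Lemma posdef_gram (R : realFieldType) m n (B : 'M[R]_(m, n)) :
  row_free B -> posdef (B *m B^T).
Proof.
move=> Bfree v vn0; rewrite mulmxA -mulmxA -trmx_mul dot_gt0 //.
by rewrite mulmx_free_eq0.
Qed.

(** Gram-Schmidt by blocks: [T] clears the first row and column, leaving the Schur complement [C'],
    which is again positive definite; the pivot is normalised by its square root. *)
Lemma posdef_orthonormal_basis (R : rcfType) n (K : 'M[R]_n) :
  K^T = K -> posdef K -> exists M : 'M[R]_n, M *m K *m M^T = 1%:M.
Proof.
elim: n K => [|n IHn] K symK posK; first by exists 0; rewrite !flatmx0.
rewrite -[n.+1]/(1 + n)%N in K symK posK *.
pose a := ulsubmx K 0 0; pose b := ursubmx K; pose C := drsubmx K.
have aE : ulsubmx K = a%:M by rewrite [LHS]mx11_scalar.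
have KE : K = block_mx a%:M b b^T C.
  by rewrite -aE /b trmx_ursub symK submxK.
have symC : C^T = C by rewrite trmx_drsub symK.
have a_gt0 : 0 < a.
  have := posK (row_mx 1 0) _; rewrite KE mul_row_block tr_row_mx mul_row_col.
  rewrite !trmx0 !mulmx0 !mul0mx !addr0 mul1mx trmx1 mulmx1 mxE eqxx mulr1n.
  apply; apply/eqP => /(congr1 lsubmx); rewrite row_mxKl linear0.
  by move/matrixP/(_ 0 0)/eqP; rewrite !mxE oner_eq0.
have an0 : a != 0 by rewrite gt_eqF.
pose T : 'M[R]_(1 + n) := block_mx 1 0 (- a^-1 *: b^T) 1%:M.
pose C' := C - a^-1 *: (b^T *m b).
have TKT : T *m K *m T^T = block_mx a%:M 0 0 C'.
  rewrite KE /T mulmx_block tr_block_mx mulmx_block.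
  rewrite !trmx0 !trmx1 !mul1mx !mulmx1 !mul0mx !mulmx0 !addr0 linearZ /= trmxK.
  rewrite mul_mx_scalar scalerA mulrN mulfV // scaleN1r mul_scalar_mx scalerA.
  rewrite mulrN mulfV // scaleN1r addNr addNr mul0mx add0r -scalemxAl scaleNr.
  by rewrite [- _ + C]addrC.
have symC' : C'^T = C'.
  by rewrite /C' linearB linearZ /= trmx_mul trmxK symC.
have posC' : posdef C'.
  move=> v vn0; have := posK (row_mx 0 v *m T) _.
  have -> w : w *m T *m K *m (w *m T)^T = w *m (T *m K *m T^T) *m w^T.
    by rewrite trmx_mul !mulmxA.
  rewrite TKT !mul_row_block tr_row_mx !mul0mx trmx0 !mulmx0 !add0r mulmx1.
  rewrite mul_row_col mul0mx add0r; apply.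
  by apply: contra vn0 => /eqP/(congr1 rsubmx); rewrite row_mxKr linear0 => ->.
have [M MC] := IHn _ symC' posC'.
exists (block_mx (Num.sqrt a)^-1%:M 0 0 M *m T).
have -> W : W *m T *m K *m (W *m T)^T = W *m (T *m K *m T^T) *m W^T.
  by rewrite trmx_mul !mulmxA.
rewrite TKT mulmx_block.
rewrite tr_block_mx mulmx_block !trmx0 !(mul0mx, mulmx0, addr0, add0r).
rewrite MC tr_scalar_mx -!scalar_mxM.
rewrite -{2}[a]sqr_sqrtr ?ltW// expr2 mulrA mulVf ?mul1r ?mulfV ?scalar_mx_block//.
all: by rewrite gt_eqF // sqrtr_gt0.
Qed.

Lemma orthonormal_row_base (R : rcfType) m n (U : 'M[R]_(m, n)) :
  exists2 V : 'M[R]_(\rank U, n), V *m V^T = 1%:M & (V :=: U)%MS.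
Proof.
have symK : (row_base U *m (row_base U)^T)^T = row_base U *m (row_base U)^T.
  by rewrite trmx_mul trmxK.
have [M MK] := posdef_orthonormal_basis symK (posdef_gram (row_base_free U)).
exists (M *m row_base U); first by rewrite trmx_mul -MK !mulmxA.
have uM : M \in unitmx by move: MK; rewrite -mulmxA => /mulmx1_unit[].
apply: eqmx_trans (eq_row_base U); apply/eqmxP; rewrite submxMl /=.
by apply/submxP; exists (invmx M); rewrite mulKmx.
Qed.

Lemma orthogonal_projector (R : rcfType) m n (U : 'M[R]_(m, n)) :
  exists Q : 'M[R]_n, [/\ Q^T = Q, Q *m Q = Q & (Q :=: U)%MS].
Proof.
have [V V1 VU] := orthonormal_row_base U; exists (V^T *m V); split.
- by rewrite trmx_mul trmxK.
- by rewrite mulmxA -[_ *m V *m V^T]mulmxA V1 mulmx1.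
- apply: eqmx_trans VU; apply/eqmxP; rewrite submxMl /=.
  by apply/submxP; exists V; rewrite mulmxA V1 mul1mx.
Qed.

(** Orthonormal coordinates on the image of [P], so that statements bounded by the rank of [P] can
    be proved for genuine matrices of that size. *)
Lemma projector_factorization (R : rcfType) n (P : 'M[R]_n) :
  P^T = P -> P *m P = P ->
  exists r (V : 'M[R]_(r, n)), [/\ r = \rank P, V *m V^T = 1%:M & V^T *m V = P].
Proof.
move=> symP idP; have [V V1 VP] := orthonormal_row_base P; exists (\rank P), V; split=> //.
have [X VE] : exists X, V = X *m P by apply/submxP; rewrite VP.
have [Y PE] : exists Y, P = Y *m V by apply/submxP; rewrite -VP.
have VPV : V *m P = V by rewrite VE -mulmxA idP.
have PVT : P *m V^T = Y.
  by have /(congr1 (mulmx^~ V^T)) /= := PE; rewrite -mulmxA V1 mulmx1.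
by rewrite -[X in X^T]VPV trmx_mul symP PVT -PE.
Qed.

Lemma skew_mx_small (R : realFieldType) r : (r <= 2)%N ->
  exists E : 'M[R]_r, forall X : 'M[R]_r, X^T = - X -> exists c, X = c *: E.
Proof.
have diag0 m (X : 'M[R]_m) i : X^T = - X -> X i i = 0.
  move=> /matrixP/(_ i i); rewrite !mxE => /eqP.
  by rewrite -addr_eq0 -mulr2n mulrn_eq0 => /eqP.
case: r => [|[|[|//]]] _.
- by exists 0 => X _; exists 0; rewrite !flatmx0.
- exists 0 => X skX; exists 0; rewrite scaler0; apply/matrixP => i j.
  by rewrite !ord1 diag0 // mxE.
- exists (delta_mx 0 1 - delta_mx 1 0) => X skX; exists (X 0 1).
  apply/matrixP => i j; have := skX => /matrixP/(_ 0 1); rewrite !mxE => X10.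
  case: (unliftP 0 i) => [i'|] ->; rewrite ?ord1; case: (unliftP 0 j) => [j'|] ->;
    rewrite ?ord1 /= ?diag0 // ?subrr ?mulr0 //.
  + have -> : lift 0 0 = 1 :> 'I_2 by apply/val_inj.
    by rewrite X10 sub0r mulrN1.
  + have -> : lift 0 0 = 1 :> 'I_2 by apply/val_inj.
    by rewrite subr0 mulr1.
Qed.

(* In dimension at most 2 the skew matrices form a line, so restrictions of skew
   operators to an invariant subspace of dimension at most 2 commute. *)
Lemma skew_commute_on_small (R : rcfType) m n (U : 'M[R]_(m, n)) (J K : 'M[R]_n) :
  (\rank U <= 2)%N -> J^T = - J -> K^T = - K ->
  (U *m J <= U)%MS -> (U *m K <= U)%MS -> U *m (J *m K - K *m J) = 0.
Proof.
move=> rU skJ skK stJ stK.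
have [V V1 VU] := orthonormal_row_base U.
have [E skE] := skew_mx_small R rU.
have stV (L : 'M[R]_n) : L^T = - L -> (U *m L <= U)%MS ->
    exists c, V *m L = c *: (E *m V).
  move=> skL stL.
  have /submxP[X VL] : (V *m L <= V)%MS by rewrite VU (submx_trans (submxMr _ _) stL) ?VU.
  have XE : X = V *m L *m V^T by rewrite VL -mulmxA V1 mulmx1.
  have /skE[c Xc] : X^T = - X.
    by rewrite XE !trmx_mul trmxK skL mulNmx mulmxN mulmxA.
  by exists c; rewrite VL Xc scalemxAl.
have [[c cV] [d dV]] := (stV _ skJ stJ, stV _ skK stK).
have /submxP[W ->] : (U <= V)%MS by rewrite VU.
rewrite -mulmxA mulmxBr !mulmxA cV dV -!scalemxAl -!mulmxA cV dV -!scalemxAr.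
by rewrite !scalerA [c * d]mulrC subrr mulmx0.
Qed.

(* In dimension at most 5 at most one eigenspace of [A] has dimension more than
   2; on the others the [J s] commute, so [l] is the exceptional eigenvalue. *)
Lemma sym_skew_scalar (R : rcfType) n (I : Type) (A : 'M[R]_n) (J : I -> 'M[R]_n) :
  (n <= 5)%N -> A^T = A -> (forall s, (J s)^T = - J s) ->
  (forall s, A *m J s = J s *m A) ->
  exists l, forall s t, (A - l%:M) *m (J s *m J t - J t *m J s) = 0.
Proof.
move=> n5 symA skJ AJ.
have /diagonalizablePeigen[rs _ rsE] := symmetric_diagonalizable symA.
have [l lP] : exists l, forall r, r != l -> (\rank (eigenspace A r) <= 2)%N.
  have [[l]|] := pselect (exists l, (2 < \rank (eigenspace A l))%N); last first.
    by move=> N; exists 0 => r _; rewrite leqNgt; apply/negP => r2; case: N; exists r.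
  move=> l2; exists l => r rl; rewrite leqNgt; apply/negP => r2.
  have dir : (eigenspace A r :&: eigenspace A l)%MS = 0.
    apply/eqP/rowV0P => v; rewrite sub_capmx => /andP[/eigenspaceP vr /eigenspaceP].
    rewrite vr => /eqP; rewrite -subr_eq0 -scalerBl scaler_eq0 subr_eq0 (negPf rl).
    by move/eqP.
  have := rank_leq_col (eigenspace A r + eigenspace A l)%MS.
  rewrite mxrank_disjoint_sum // leqNgt => /negP; apply.
  by rewrite (leq_ltn_trans n5) // (leq_trans _ (leq_add r2 l2)).
exists l => s t; set B := _ - _.
(* The vanishing is read as the inclusion of the whole space in a kernel; as [A] is diagonalizable,
   the whole space is the sum of its eigenspaces, which are checked one by one. *)
rewrite -[LHS]mul1mx; apply/sub_kermxP.
rewrite -rsE; elim/big_rec: _ => [|r U _ UP]; first exact: sub0mx.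
rewrite addsmx_sub UP andbT; apply/sub_kermxP.
have /eigenspaceP EA := submx_refl (eigenspace A r).
have EAl : eigenspace A r *m (A - l%:M) = (r - l) *: eigenspace A r.
  by rewrite mulmxBr EA mul_mx_scalar -scalerBl.
rewrite mulmxA EAl.
have [->|rl] := eqVneq r l; first by rewrite subrr scale0r mul0mx.
rewrite -scalemxAl skew_commute_on_small ?scaler0 ?lP //.
all: by apply: comm_mx_stable_eigenspace; rewrite /comm_mx AJ.
Qed.

Lemma sum_row_mul (R : comPzRingType) m n p (X : 'M[R]_(m, n)) (Y : 'M[R]_(m, p)) :
  \sum_k (row k X)^T *m row k Y = X^T *m Y.
Proof.
apply/matrixP => i j; rewrite summxE !mxE; apply: eq_bigr => k _.
by rewrite !mxE big_ord1 !mxE.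
Qed.

Lemma bilinear_form_tr (R : comPzRingType) n (f : 'rV[R]_n) (M : 'M[R]_n) (g : 'rV[R]_n) :
  f *m M *m g^T = g *m M^T *m f^T.
Proof.
have -> : f *m M *m g^T = (g *m M^T *m f^T)^T by rewrite !trmx_mul !trmxK mulmxA.
by apply/matrixP => i j; rewrite mxE !ord1.
Qed.

Lemma quadratic_form0 (R : realFieldType) n (M : 'M[R]_n) :
  (forall a : 'rV_n, a *m M *m a^T = 0) -> M^T = - M.
Proof.
move=> M0; have E (a b : 'rV_n) : a *m M *m b^T + b *m M *m a^T = 0.
  have := M0 (a + b); rewrite linearD /= !mulmxDl !mulmxDr !M0 add0r addr0.
  by move=> <-.
apply/matrixP => i j; rewrite !mxE; apply/eqP; rewrite -addr_eq0.
have /matrixP/(_ 0 0) := E (delta_mx 0 i) (delta_mx 0 j).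
by rewrite -!rowE !trmx_delta -!colE !mxE addrC => /eqP.
Qed.

Lemma scale_half_double (R : numFieldType) (V : lmodType R) (x : V) :
  2^-1 *: (x + x) = x.
Proof.
by rewrite -mulr2n -[x *+ 2]scaler_nat scalerA mulVf ?scale1r // pnatr_eq0.
Qed.

Lemma rank_compl_projector (R : rcfType) n (P : 'M[R]_n) :
  P *m P = P -> (\rank P + \rank (1%:M - P)%R = n)%N.
Proof.
move=> idP; rewrite -mxrank_disjoint_sum.
  apply/eqP; rewrite -[_ == _]/(row_full _) -sub1mx.
  by rewrite -[1%:M in X in (X <= _)%MS](subrK P) addrC addmx_sub_adds.
apply/eqP/rowV0P => v; rewrite sub_capmx => /andP[/submxP[X ->] /submxP[Y XY]].
by rewrite -idP mulmxA XY -mulmxA mulmxBl idP mul1mx subrr mulmx0.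
Qed.

(* [J k i j] is the structure constant <[e_i, e_j], e_k> in an orthonormal basis
   of the Lie algebra, so that [x *m J k *m y^T] is the [k]-th component of
   [x, y]; [nil] says that double brackets vanish. *)
Section Decomposition.
Context (R : rcfType) (n : nat) (J : 'I_n -> 'M[R]_n) (S : 'M[R]_n).
Hypothesis n7 : (n <= 7)%N.
Hypothesis skJ : forall k, (J k)^T = - J k.
Hypothesis nil : forall i j k m, \sum_l J l i j * J k l m = 0.
Hypothesis symS : S^T = S.
Hypothesis killS : forall x : 'rV[R]_n, \sum_k x 0 k *: (x *m J k *m S *m x^T) = 0.

(** A vector [x] is central iff every [x *m J k] is zero. The [J k] being skew, their row spaces
    together span the orthogonal complement v of the centre, and [P] is the projector onto it. The
    coefficients [X] are kept because they later produce functions with differential [P]. *)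
Lemma derived_complement_projector :
  exists P X, [/\ P^T = P, P *m P = P, P = \sum_k X k *m J k &
    forall k, J k *m P = J k].
Proof.
have [P [symP idP PE]] := orthogonal_projector (\sum_k <<J k>>)%MS.
have [X PX] : exists X : 'I_n -> 'M[R]_n, P = \sum_k X k *m J k.
  have /sub_sumsmxP[X PX] : (P <= \sum_k <<J k>>)%MS by rewrite PE.
  have JX k : exists Z, X k *m <<J k>>%MS = Z *m J k.
    by apply/submxP; rewrite -(genmxE (J k)) submxMl.
  by have [Z ZE] := choice JX; exists Z; rewrite PX; apply: eq_bigr.
exists P, X; split=> // k.
have /submxP[Z ->] : (J k <= P)%MS.
  by rewrite PE (sumsmx_sup k) // genmxE.
by rewrite -mulmxA idP.
Qed.

(** Frame components of a vector field as polynomials in f; the factor one half makes a symmetric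
    [G j] the Hessian of the [j]-th component. *)
Definition quad_field (w : 'rV[R]_n) (L : 'M[R]_n) (G : 'I_n -> 'M[R]_n)
    (f : 'rV[R]_n) : 'rV[R]_n :=
  w + f *m L + \row_j (2^-1 * (f *m G j *m f^T) 0 0).

Lemma quad_field_linear w L f : quad_field w L (fun=> 0) f = w + f *m L.
Proof.
apply/rowP => j.
by rewrite mxE [X in _ + X]mxE mulmx0 mul0mx [X in _ * X]mxE mulr0 addr0.
Qed.

(* If [f] has derivative [row i P] along [e_i], the field with components
   [u = quad_field w L G f] has derivative [row i L + (f *m G j)_i], and the
   last condition says that it is Killing. *)
Definition quad_killing (P : 'M[R]_n) (u : 'rV[R]_n -> 'rV[R]_n) :=
  exists w L G, [/\ u = quad_field w L G, P *m L = L,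
    forall j, (G j)^T = G j, forall j, P *m G j = G j &
    forall f i j, L i j + (f *m G j) 0 i - (u f *m J j) 0 i
                + (L j i + (f *m G i) 0 j - (u f *m J i) 0 j) = 0].

(** The matrix counterpart of the Killing part of a decomposable tensor. [T] is a function of f
    because single products of Killing fields are not left-invariant, even when their sum is. *)
Definition sym_span (P : 'M[R]_n) (T : 'rV[R]_n -> 'M[R]_n) :=
  exists (m : nat) (c : 'I_m -> R) (u v : 'I_m -> 'rV[R]_n -> 'rV[R]_n),
    [/\ forall k, quad_killing P (u k), forall k, quad_killing P (v k) &
    forall f, T f = \sum_k c k *: ((u k f)^T *m v k f + (v k f)^T *m u k f)].

Lemma sym_spanD P T T' :
  sym_span P T -> sym_span P T' -> sym_span P (fun f => T f + T' f).
Proof.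
move=> [m [c [u [v [Ku Kv TE]]]]] [m' [c' [u' [v' [Ku' Kv' TE']]]]].
pose glue A (a : 'I_m -> A) (a' : 'I_m' -> A) (k : 'I_(m + m')) :=
  match fintype.split k with inl i => a i | inr i => a' i end.
exists (m + m')%N, (glue _ c c'), (glue _ u u'), (glue _ v v'); split.
- by move=> k; rewrite /glue; case: fintype.split.
- by move=> k; rewrite /glue; case: fintype.split.
move=> f; rewrite TE TE' big_split_ord /=; congr (_ + _); apply: eq_bigr => k _.
  by rewrite /glue (unsplitK (inl k)).
by rewrite /glue (unsplitK (inr k)).
Qed.

(** Handles a family of [n] products, one for each row, as a single matrix expression. *)
Lemma sym_span_rows P c (X Y : 'rV[R]_n -> 'M[R]_n) :
  (forall k, quad_killing P (fun f => row k (X f))) ->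
  (forall k, quad_killing P (fun f => row k (Y f))) ->
  sym_span P (fun f => c *: ((X f)^T *m Y f + (Y f)^T *m X f)).
Proof.
move=> KX KY; exists n, (fun=> c), (fun k f => row k (X f)), (fun k f => row k (Y f)).
by split=> // f; rewrite -scaler_sumr big_split /= !sum_row_mul.
Qed.

(** * The splitting into the centre (image of [Q]) and its complement v (image of [P]) *)

Section Projector.
Variables (P : 'M[R]_n) (X : 'I_n -> 'M[R]_n).
Hypotheses (symP : P^T = P) (idP : P *m P = P).
Hypotheses (PX : P = \sum_k X k *m J k) (JP : forall k, J k *m P = J k).
Variable Q : 'M[R]_n.
Hypothesis QE : Q = 1%:M - P.

Let PJ k : P *m J k = J k.
Proof.
by apply: trmx_inj; rewrite trmx_mul symP skJ mulNmx JP.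
Qed.

Let JQ k : J k *m Q = 0.
Proof. by rewrite QE mulmxBr mulmx1 JP subrr. Qed.

Let QJ k : Q *m J k = 0.
Proof. by rewrite QE mulmxBl mul1mx PJ subrr. Qed.

Let symQ : Q^T = Q.
Proof. by rewrite QE linearB /= trmx1 symP. Qed.

Let QQ : Q *m Q = Q.
Proof. by rewrite QE mulmxBl mul1mx mulmxBr mulmx1 idP subrr subr0. Qed.

(** Brackets have no component in v: inserting the expression of [P] by the [J m] turns that
    component into double brackets, which vanish by [nil]. *)
Let sum_PJ l : \sum_k P k l *: J k = 0.
Proof.
apply/matrixP => i j; rewrite summxE mxE.
transitivity (- \sum_m \sum_b X m l b * (\sum_k J k i j * J m k b)).
  rewrite -sumrN; transitivity (\sum_k \sum_m \sum_b - (X m l b * (J k i j * J m k b))).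
    apply: eq_bigr => k _; rewrite mxE -[P]symP mxE PX summxE mulr_suml.
    apply: eq_bigr => m _; rewrite mxE mulr_suml; apply: eq_bigr => b _.
    have /matrixP/(_ b k) := skJ m; rewrite !mxE => ->; ring.
  rewrite exchange_big; apply: eq_bigr => m _; rewrite exchange_big -sumrN.
  by apply: eq_bigr => b _; rewrite mulr_sumr -sumrN.
rewrite big1 ?oppr0 // => m _; rewrite big1 // => b _.
by rewrite nil mulr0.
Qed.

Let sum_QJ l : \sum_k Q k l *: J k = J l.
Proof.
rewrite (bigD1 l) //= (eq_bigr (fun k => - (P k l *: J k))); last first.
  by move=> k /negPf kl; rewrite QE !mxE kl sub0r scaleNr.
rewrite QE !mxE eqxx scalerBl scale1r sumrN -addrA -opprD.
by have := sum_PJ l; rewrite (bigD1 l) //= => ->; rewrite subr0.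
Qed.

(** The map j(b), extended to all [b]; by [JmapP] the extension is zero on v. *)
Definition Jmap (b : 'rV[R]_n) := \sum_k b 0 k *: J k.

Let JmapQ b : Jmap (b *m Q) = Jmap b.
Proof.
transitivity (\sum_l b 0 l *: \sum_k Q k l *: J k); last first.
  by apply: eq_bigr => l _; rewrite sum_QJ.
rewrite /Jmap (eq_bigr (fun k => \sum_l (b 0 l * Q k l) *: J k)); last first.
  move=> k _; rewrite mxE scaler_suml; apply: eq_bigr => l _.
  by rewrite -[in LHS]symQ mxE.
rewrite exchange_big; apply: eq_bigr => l _; rewrite scaler_sumr.
by apply: eq_bigr => k _; rewrite scalerA.
Qed.

Let JmapP b : Jmap (b *m P) = 0.
Proof.
have -> : P = 1%:M - Q by rewrite QE opprB addrCA subrr addr0.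
rewrite /Jmap (eq_bigr (fun k => b 0 k *: J k - (b *m Q) 0 k *: J k)); last first.
  by move=> k _; rewrite mulmxBr mulmx1 !mxE scalerBl.
by rewrite sumrB -[X in _ - X]/(Jmap _) JmapQ subrr.
Qed.

Let JmapD a b : Jmap (a + b) = Jmap a + Jmap b.
Proof. by rewrite -big_split; apply: eq_bigr => k _; rewrite mxE scalerDl. Qed.

Let Jmap_delta k : Jmap (delta_mx 0 k) = J k.
Proof.
rewrite /Jmap (bigD1 k) //= mxE !eqxx scale1r big1 ?addr0 // => l /negPf lk.
by rewrite mxE lk scale0r.
Qed.

Let killJ (x : 'rV[R]_n) : x *m Jmap x *m S *m x^T = 0.
Proof.
rewrite -[RHS](killS x) mulmx_sumr !mulmx_suml; apply: eq_bigr => k _.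
by rewrite -scalemxAr -!scalemxAl.
Qed.

(** The Killing condition at [a *m P + b *m Q]: only the central part enters j, and j acts only on
    the part in v. *)
Let kill_split (a b : 'rV[R]_n) :
  a *m Jmap b *m S *m P *m a^T + a *m Jmap b *m S *m Q *m b^T = 0.
Proof.
have := killJ (a *m P + b *m Q).
rewrite JmapD JmapP JmapQ add0r mulmxDl.
have PJm c : P *m Jmap c = Jmap c.
  by rewrite mulmx_sumr; apply: eq_bigr => k _; rewrite -scalemxAr PJ.
have QJm c : Q *m Jmap c = 0.
  by rewrite mulmx_sumr big1 // => k _; rewrite -scalemxAr QJ scaler0.
rewrite -!mulmxA PJm QJm mulmx0 addr0 linearD /= !trmx_mul symP symQ.
by rewrite !mulmxDr !mulmxA.
Qed.

(** The two terms of [kill_split] are quadratic and linear in [a], so comparison with [- a]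
    separates them. *)
Let kill_vv (a b : 'rV[R]_n) : a *m (Jmap b *m S *m P) *m a^T = 0.
Proof.
have := kill_split a b; have := kill_split (- a) b.
rewrite !mulNmx linearN /= mulmxN opprK !mulmxA => E1 E2.
have /eqP : 2 *: (a *m Jmap b *m S *m P *m a^T) = 0.
  rewrite scaler_nat mulr2n -[RHS]addr0 -[X in _ = X + _]E1 -[X in _ = _ + X]E2.
  by rewrite addrACA addNr addr0.
by rewrite scaler_eq0 pnatr_eq0 => /eqP.
Qed.

Let kill_vz (b : 'rV[R]_n) : Jmap b *m S *m Q *m b^T = 0.
Proof.
apply/row_matrixP => i; rewrite row0 rowE.
have := kill_split (delta_mx 0 i) b; have := kill_vv (delta_mx 0 i) b.
by rewrite !mulmxA => ->; rewrite add0r.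
Qed.

Let A := P *m S *m P.

Let symA : A^T = A.
Proof. by rewrite /A !trmx_mul symP symS mulmxA. Qed.

(** By [kill_vv] the quadratic form of [J k *m S *m P] is zero, so this matrix is skew; transposing
    it gives the commutation. *)
Let AJ k : A *m J k = J k *m A.
Proof.
have := quadratic_form0 (fun a => kill_vv a (delta_mx 0 k)).
rewrite Jmap_delta !trmx_mul symP symS skJ !mulmxN => /oppr_inj.
by rewrite /A !mulmxA JP => <-; rewrite -!mulmxA PJ.
Qed.

(** Polarization of [kill_vz]. It is what makes the f-dependence of the mixed part cancel in the
    end. *)
Let JSQ k l :
  J k *m S *m Q *m delta_mx l (0 : 'I_1) = - (J l *m S *m Q *m delta_mx k 0).
Proof.
rewrite -(trmx_delta _ 0 l) -(trmx_delta _ 0 k); have := kill_vz (delta_mx 0 k + delta_mx 0 l).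
rewrite JmapD [(_ + _)^T]linearD /= !mulmxDl !mulmxDr !Jmap_delta.
have := kill_vz (delta_mx 0 k); have := kill_vz (delta_mx 0 l).
rewrite !Jmap_delta => -> ->; rewrite add0r addr0 => /eqP.
by rewrite addr_eq0 => /eqP.
Qed.

Let scalar_part : exists l, forall s t,
  (A - l *: P) *m (J s *m J t) = (A - l *: P) *m (J t *m J s).
Proof.
have [P5|P6] := leqP (\rank P) 5.
  (* Conjugation by [V] is multiplicative on matrices supported on the image of [P] and turns
     [l *: P] into a scalar matrix of size at most 5. *)
  have [r [V [rP V1 VP]]] := projector_factorization symP idP.
  have VPV : V *m P = V by rewrite -[in LHS]VP mulmxA V1 mul1mx.
  have VV (B C : 'M[R]_n) : B *m P = B ->
      V *m B *m V^T *m (V *m C *m V^T) = V *m (B *m C) *m V^T.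
    by move=> BP; rewrite -[in RHS]BP -VP !mulmxA.
  have AP : A *m P = A by rewrite /A -!mulmxA idP.
  have PA : P *m A = A by rewrite /A !mulmxA idP.
  have [||s|s|l lP] := @sym_skew_scalar R _ _ (V *m A *m V^T) (fun s => V *m J s *m V^T).
  - by rewrite rP.
  - by rewrite trmx_mul trmxK trmx_mul symA mulmxA.
  - by rewrite !trmx_mul trmxK skJ mulNmx mulmxN mulmxA.
  - by rewrite !VV // AJ.
  exists l => s t; apply/eqP; rewrite -subr_eq0 -mulmxBr; apply/eqP.
  have := lP s t; rewrite !VV // -mulmxBl -mulmxBr.
  have -> : V *m A *m V^T - l%:M = V *m (A - l *: P) *m V^T.
    by rewrite mulmxBr mulmxBl -scalemxAr VPV -scalemxAl V1 scalemx1.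
  rewrite VV; last by rewrite mulmxBl AP -scalemxAl idP.
  move=> /(congr1 (fun M => V^T *m M *m V)); rewrite mulmx0 mul0mx.
  rewrite !mulmxA VP -[_ *m V^T *m V]mulmxA VP -[_ *m (_ - _) *m P]mulmxA.
  rewrite [_ *m P]mulmxBl -!mulmxA !JP => <-; rewrite !mulmxA; congr (_ *m _).
  by rewrite mulmxBr PA -scalemxAr idP.
(* Now [P] has rank at least 6, so the centre is at most a line and all [J l] are multiples of one
   matrix. They commute, and the scalar 0 will do. *)
have [v Jv] : exists v : 'I_n -> R, exists K, forall l, J l = v l *: K.
  have Q1 : (\rank Q <= 1)%N.
    have := rank_compl_projector idP; rewrite -QE => rPQ.
    by rewrite -(leq_add2l (\rank P)) rPQ (leq_trans n7) // addn1.
  have [r [V [rQ _ VQ]]] := projector_factorization symQ QQ.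
  have VJ l : J l = \sum_a V a l *: \sum_k V a k *: J k.
    rewrite -[LHS]sum_QJ -VQ.
    under eq_bigr => k _ do rewrite mxE scaler_suml.
    rewrite exchange_big; apply: eq_bigr => a _; rewrite scaler_sumr.
    by apply: eq_bigr => k _; rewrite !mxE scalerA mulrC.
  rewrite -rQ in Q1; case: r Q1 V VJ {rQ VQ} => [|[|//]] _ V VJ.
    by exists (fun=> 0), 0 => l; rewrite VJ big_ord0 scaler0.
  by exists (V 0), (\sum_k V 0 k *: J k) => l; rewrite VJ big_ord1.
have [K JK] := Jv; exists 0 => s t; rewrite !JK -!scalemxAl -!scalemxAr.
by rewrite !scalerA [v s * _]mulrC.
Qed.

(* [y *m brmx f] is the bracket [f, y]. *)
Definition brmx (f : 'rV[R]_n) := \matrix_(i, k) (f *m J k) 0 i.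

Let brmxE (y f : 'rV[R]_n) l : (y *m brmx f) 0 l = (f *m J l *m y^T) 0 0.
Proof. by rewrite !mxE; apply: eq_bigr => i _; rewrite !mxE mulrC. Qed.

Let brmx_anti (w f : 'rV[R]_n) : w *m brmx f = - (f *m brmx w).
Proof.
apply/rowP => l; rewrite [RHS]mxE !brmxE bilinear_form_tr skJ mulmxN mulNmx.
by rewrite mxE.
Qed.

Let brmxJ w k : brmx w *m J k = 0.
Proof.
apply/matrixP => a b; rewrite !mxE.
transitivity (\sum_c w 0 c * \sum_l J l c a * J k l b).
  under eq_bigr => l _ do rewrite !mxE mulr_suml.
  rewrite exchange_big; apply: eq_bigr => c _; rewrite mulr_sumr.
  by apply: eq_bigr => l _; rewrite mulrA.
by rewrite big1 // => c _; rewrite nil mulr0.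
Qed.

Let tr_brmx_row w k : row k (brmx w)^T = w *m J k.
Proof. by apply/rowP => i; rewrite !mxE. Qed.

Let tr_brmxQ w : (brmx w)^T *m Q = 0.
Proof.
apply/row_matrixP => k; rewrite row_mul tr_brmx_row -mulmxA JQ mulmx0.
by rewrite row0.
Qed.

Let Qbrmx w : Q *m brmx w = 0.
Proof. by apply: trmx_inj; rewrite trmx_mul symQ tr_brmxQ trmx0. Qed.

Let Pbrmx w : P *m brmx w = brmx w.
Proof.
have -> : P = 1%:M - Q by rewrite QE opprB addrCA subrr addr0.
by rewrite mulmxBl mul1mx Qbrmx subr0.
Qed.

Let brmxQ w : brmx w *m Q = brmx w.
Proof.
apply/matrixP => i l; rewrite [RHS]mxE -[in RHS](sum_QJ l) mulmx_sumr summxE mxE.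
by apply: eq_bigr => k _; rewrite mxE -scalemxAr [RHS]mxE mulrC.
Qed.

(** Right-invariant fields generate left translations, which are isometries. In the Killing equation
    [L i j] equals the [i]-th entry of [w *m J j], and the part depending on f is a bracket, hence
    killed by the [J]'s. *)
Lemma quad_killing_right_invariant w :
  quad_killing P (fun f => w *m (1%:M - brmx f)).
Proof.
exists w, (brmx w), (fun=> 0); split.
- apply: funext => f; rewrite mulmxBr mulmx1 brmx_anti opprK.
  by rewrite quad_field_linear.
- exact: Pbrmx.
- by move=> j; rewrite trmx0.
- by move=> j; rewrite mulmx0.
move=> f i j; have E k : w *m (1%:M - brmx f) *m J k = w *m J k.
  by rewrite mulmxBr mulmx1 mulmxBl -mulmxA brmxJ mulmx0 subr0.
by rewrite !E !mulmx0 !mxE !addr0 !subrr addr0.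
Qed.

Lemma quad_killing_central w : quad_killing P (fun f => w *m Q).
Proof.
exists (w *m Q), 0, (fun=> 0); split.
- by apply: funext => f; rewrite quad_field_linear mulmx0 addr0.
- by rewrite mulmx0.
- by move=> j; rewrite trmx0.
- by move=> j; rewrite mulmx0.
by move=> f i j; rewrite -!mulmxA !QJ !mulmx0 !mxE !(subr0, addr0).
Qed.

(* [D] is a skew derivation that vanishes on the centre. *)
Lemma quad_killing_rotation D : D^T = - D -> P *m D = D ->
  (forall j, J j *m D = D *m J j) ->
  quad_killing P (fun f => f *m D - 2^-1 *: (f *m D *m brmx f)).
Proof.
move=> skD PD JD.
(* The term -[f, f D] / 2 is the quadratic part with Hessians [J j *m D], symmetric because [J j]
   and [D] are commuting skew matrices. *)
have E f : f *m D - 2^-1 *: (f *m D *m brmx f) = quad_field 0 D (fun j => J j *m D) f.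
  rewrite /quad_field add0r; congr (_ + _); apply/rowP => j.
  rewrite mxE [X in - X]mxE brmxE trmx_mul skD mulNmx mulmxN [X in _ * X]mxE mulrN opprK.
  by rewrite [RHS]mxE !mulmxA.
exists 0, D, (fun j => J j *m D); split=> //.
- exact: funext.
- by move=> j; rewrite trmx_mul skD skJ mulNmx mulmxN opprK JD.
- by move=> j; rewrite mulmxA PJ.
move=> f i j.
(* So the bracket terms equal the terms in the Hessians and cancel them; what is left is the sum of
   [D] and its transpose. *)
have uJ k : (f *m D - 2^-1 *: (f *m D *m brmx f)) *m J k = f *m (J k *m D).
  by rewrite mulmxBl -scalemxAl -[_ *m brmx f *m _]mulmxA brmxJ mulmx0 scaler0 subr0 -mulmxA JD.
rewrite !uJ !addrK; have /matrixP/(_ i j) := skD; rewrite !mxE => ->.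
by rewrite subrr.
Qed.

Lemma sym_span_decomposition : exists l, sym_span P (fun=> S - l%:M).
Proof.
have [l lP] := scalar_part; exists l; pose B := A - l *: P.
have BJ k : B *m J k = J k *m B.
  by rewrite mulmxBl mulmxBr AJ -scalemxAl PJ -scalemxAr JP.
have symB : B^T = B by rewrite linearB linearZ /= symA symP.
have PB : P *m B = B.
  by rewrite /B mulmxBr /A -scalemxAr idP !mulmxA idP.
have BJJ s t : B *m J s *m J t = B *m J t *m J s by rewrite -!mulmxA lP.
pose M f := 1%:M - brmx f.
(* [W] is the part of S - l on the centre, and row [k] of [U f] below is the field rot(B j(z_k)) of
   the overview. *)
pose W := Q *m S *m Q - l *: Q.
pose U f := (brmx f)^T *m B *m (1%:M - 2^-1 *: brmx f).
(* With [M = 1 - brmx f] the right-invariant fields give [M^T B M]; the cross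
   terms are cancelled by the rotations [U], paired with the centre. *)
have Mspan : sym_span P (fun f => 2^-1 *: ((M f)^T *m (B *m M f) + (B *m M f)^T *m M f)).
  apply: sym_span_rows => k.
    rewrite (_ : (fun _ => _) = fun f => row k 1%:M *m M f).
      exact: quad_killing_right_invariant.
    by apply: funext => f; rewrite -row_mul mul1mx.
  rewrite (_ : (fun _ => _) = fun f => row k B *m M f).
    exact: quad_killing_right_invariant.
  by apply: funext => f; rewrite -row_mul.
have Qkill k : quad_killing P (fun=> row k Q).
  rewrite (_ : (fun _ => _) = fun=> row k Q *m Q).
    exact: quad_killing_central.
  by apply: funext => f; rewrite -row_mul QQ.
have Uspan : sym_span P (fun f => 1 *: (Q^T *m U f + (U f)^T *m Q)).
  apply: sym_span_rows => // k.
  rewrite (_ : (fun _ => _) = fun f => f *m (B *m J k)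
     - 2^-1 *: (f *m (B *m J k) *m brmx f)).
    apply: quad_killing_rotation.
    - by rewrite trmx_mul skJ symB mulNmx BJ.
    - by rewrite mulmxA PB.
    - by move=> j; rewrite mulmxA -BJ BJJ.
  apply: funext => f; rewrite /U !row_mul tr_brmx_row -[f *m J k *m B]mulmxA -BJ mulmxBr mulmx1.
  by rewrite -scalemxAr.
have Xspan : sym_span P (fun f => 1 *: (Q^T *m (Q *m S *m P *m M f)
     + (Q *m S *m P *m M f)^T *m Q)).
  apply: sym_span_rows => // k.
  rewrite (_ : (fun _ => _) = fun f => row k (Q *m S *m P) *m M f).
    exact: quad_killing_right_invariant.
  by apply: funext => f; rewrite -row_mul.
have Wspan : sym_span P (fun f => 2^-1 *: (Q^T *m W + W^T *m Q)).
  apply: sym_span_rows => // k.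
  rewrite (_ : (fun _ => _) = fun=> row k W *m Q).
    exact: quad_killing_central.
  by apply: funext => f; rewrite -row_mul /W mulmxBl -scalemxAl -!mulmxA QQ.
have := sym_spanD (sym_spanD Mspan Uspan) (sym_spanD Xspan Wspan).
congr sym_span; apply: funext => f.
(* Replacing the vectors of v by right-invariant fields in the mixed part adds
   [Q *m S *m P *m brmx f], up to sign. By [JSQ] this matrix is skew, so it disappears in the
   symmetric product. *)
have XF : Q *m S *m P *m brmx f + (Q *m S *m P *m brmx f)^T = 0.
  apply/matrixP => k m; have E a b : (Q *m S *m P *m brmx f) a b =
      (f *m (J b *m S *m Q *m delta_mx a (0 : 'I_1))) 0 0.
    transitivity (((delta_mx 0 a : 'rV_n) *m (Q *m S *m P) *m brmx f) 0 b).
      by rewrite -rowE -row_mul [RHS]mxE.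
    rewrite brmxE !trmx_mul symP symS symQ trmx_delta !mulmxA.
    by rewrite -[f *m _ *m P]mulmxA JP.
  by rewrite mxE [X in _ + X]mxE !E [RHS]mxE JSQ mulmxN mxE addNr.
have M1 : 2^-1 *: ((M f)^T *m (B *m M f) + (B *m M f)^T *m M f)
    = (M f)^T *m B *m M f.
  by rewrite trmx_mul symB mulmxA scale_half_double.
have W1 : 2^-1 *: (Q^T *m W + W^T *m Q) = W.
  have symW : W^T = W by rewrite linearB linearZ /= !trmx_mul symQ symS mulmxA.
  have QW : Q *m W = W.
    by rewrite /W mulmxBr -scalemxAr !mulmxA QQ.
  have WQ : W *m Q = W by apply: trmx_inj; rewrite trmx_mul symQ symW QW.
  by rewrite symW symQ QW WQ scale_half_double.
rewrite M1 W1 !scale1r.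
have QU : Q^T *m U f = U f.
  rewrite symQ /U !mulmxA; congr (_ *m _ *m _).
  by apply: trmx_inj; rewrite trmx_mul symQ trmxK brmxQ.
have UQ : (U f)^T *m Q = (U f)^T.
  by apply: trmx_inj; rewrite trmx_mul trmxK -[RHS]QU.
have QX : Q^T *m (Q *m S *m P *m M f) = Q *m S *m P *m M f.
  by rewrite symQ !mulmxA QQ.
have XQ : (Q *m S *m P *m M f)^T *m Q = (Q *m S *m P *m M f)^T.
  by apply: trmx_inj; rewrite trmx_mul trmxK -[RHS]QX.
rewrite QU UQ QX XQ.
(* With b = [brmx f], the first term is B - b^T B - B b + b^T B b, and U + U^T is b^T B + B b - b^T
   B b: the one half in the rotations is exactly what the quadratic term requires. *)
have -> : (M f)^T *m B *m M f + (U f + (U f)^T) = B.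
  have -> : (M f)^T = 1%:M - (brmx f)^T by rewrite linearB /= trmx1.
  have -> : (U f)^T = (1%:M - 2^-1 *: (brmx f)^T) *m B *m brmx f.
    by rewrite !trmx_mul trmxK symB linearB linearZ /= trmx1 mulmxA.
  rewrite /M /U.
  rewrite !(mulmxBl, mulmxBr) !mul1mx !mulmx1 -!scalemxAl -!scalemxAr !mulmxA.
  move: ((brmx f)^T *m B) (B *m brmx f) ((brmx f)^T *m B *m brmx f) => x y z.
  by apply/matrixP => i j; rewrite !mxE; field.
have -> : Q *m S *m P *m M f + (Q *m S *m P *m M f)^T = Q *m S *m P + P *m S *m Q.
  have -> : P *m S *m Q = (Q *m S *m P)^T by rewrite !trmx_mul symP symS symQ mulmxA.
  move: (Q *m S *m P) XF => Y XF; rewrite /M mulmxBr mulmx1 linearB /=.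
  by rewrite addrACA -opprD XF subr0.
have PQ : P + Q = 1%:M by rewrite QE addrCA subrr addr0.
have SE : S = A + Q *m S *m P + (P *m S *m Q + Q *m S *m Q).
  by rewrite /A -!mulmxDl -mulmxDr PQ mul1mx mulmx1.
have lE : l%:M = l *: P + l *: Q by rewrite -scalerDr PQ scalemx1.
rewrite [X in _ = X - _]SE lE /B /W.
move: (Q *m S *m P) (P *m S *m Q) (Q *m S *m Q) A => x y z A'.
by apply/matrixP => i j; rewrite !mxE; ring.
Qed.

End Projector.

Lemma killing_form_decomposition : exists P X l,
  [/\ P^T = P, P = \sum_k X k *m J k & sym_span P (fun=> S - l%:M)].
Proof.
have [P [X [symP idP PX JP]]] := derived_complement_projector.
have [l lP] := sym_span_decomposition symP idP PX JP (erefl _).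
by exists P, X, l.
Qed.

End Decomposition.

(** * Calculus *)

Section NearEq.
Context {R : realType} {V W : normedModType R}.
Implicit Types (f g : V -> W) (x : V).

(** Identities involving charts hold only near a point, so differentials must be compared on germs;
    the little-o expansion of [f] at [x] is also one for [g]. *)
Lemma near_eq_diff f g x : {near x, f =1 g} -> differentiable f x ->
  differentiable g x /\ ('d g x = 'd f x :> (V -> W)).
Proof.
move=> fg df; have cdf : continuous ('d f x) by exact: diff_continuous.
have gE : g \o shift x = cst (g x) + 'd f x +o_ 0 id.
  have fE := diff_locally df.
  apply/eqaddoP => e e0; have /eqaddoP/(_ e e0) fe := fE.
  have fg0 : \forall h \near (0 : V), f (h + x) = g (h + x).
    by have := fg; rewrite (near_shift 0) subr0 /= => H; near=> h; exact: (near H h).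
  near=> h.
  have -> : (g \o shift x - (cst (g x) + 'd f x)) h
          = (f \o shift x - (cst (f x) + 'd f x)) h.
    have := nbhs_singleton fg; have : f (h + x) = g (h + x) by near: h.
    by rewrite /= !fctE /= => -> ->.
  by near: h.
have E := diff_unique cdf gE.
split; last exact: E.
by apply/diff_locallyP; rewrite E.
Unshelve. all: by end_near. Qed.

End NearEq.

(** * Closure properties of C^k functions on open sets *)

Section Ck.
Context {R : realType} {V W : normedModType R}.
Implicit Types (U : set V) (f g : V -> W) (k : nat).

(** Since [U] is a neighbourhood of each of its points, equality on [U] passes to the derivatives,
    and the induction can proceed. *)
Lemma Ck_on_ext k U f g : open U -> (forall x, U x -> f x = g x) ->
  Ck_on k U f -> Ck_on k U g.
Proof.
move=> oU; elim: k f g => [|k IHk] f g fg.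
  move=> Cf x Ux; have nfg : {near x, f =1 g}.
    by near=> y; apply: fg; near: y; exact: open_nbhs_nbhs.
  rewrite /prop_for /continuous_at -fg //; apply: cvg_trans (Cf x Ux).
  by apply: near_eq_cvg; near=> y; near: y.
move=> [df Cf].
have nfg x : U x -> {near x, f =1 g}.
  by move=> Ux; near=> y; apply: fg; near: y; exact: open_nbhs_nbhs.
split=> [x Ux|v]; first by have [] := near_eq_diff (nfg x Ux) (df x Ux).
apply: IHk (Cf v) => x Ux; exact: near_eq_derive (nfg x Ux).
Unshelve. all: by end_near. Qed.

Lemma Ck_onW k U f : Ck_on k.+1 U f -> Ck_on k U f.
Proof.
elim: k f => [|k IHk] f [df Cf].
  by move=> x Ux; exact: differentiable_continuous (df x Ux).
by split=> // v; exact/IHk/Cf.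
Qed.

Lemma Ck_on_sub k U U' f : U' `<=` U -> Ck_on k U f -> Ck_on k U' f.
Proof.
move=> sU; elim: k f => [|k IHk] f; first by move=> Cf x /sU/Cf.
by move=> [df Cf]; split=> [x /sU/df//|v]; exact/IHk/Cf.
Qed.

Lemma Ck_on_cst k U (c : W) : Ck_on k U (cst c).
Proof.
elim: k c => [|k IHk] c; first by move=> x _; exact: cst_continuous.
split=> [x _|v]; first exact: differentiable_cst.
by rewrite (_ : 'D_v _ = cst 0) //; apply/funext => x; rewrite derive_cst.
Qed.

Lemma Ck_onD k U f g : open U ->
  Ck_on k U f -> Ck_on k U g -> Ck_on k U (f \+ g).
Proof.
move=> oU; elim: k f g => [|k IHk] f g.
  by move=> Cf Cg x Ux; apply: continuousD; [exact: Cf|exact: Cg].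
move=> [df Cf] [dg Cg]; split=> [x Ux|v].
  by apply: differentiableD; [exact: df|exact: dg].
apply: (Ck_on_ext oU) (IHk _ _ (Cf v) (Cg v)) => x Ux.
by rewrite /= deriveD //; apply: diff_derivable; [exact: df|exact: dg].
Qed.

Lemma Ck_on_sum k U (I : Type) (r : seq I) (F : I -> V -> W) : open U ->
  (forall i, Ck_on k U (F i)) -> Ck_on k U (fun x => \sum_(i <- r) F i x).
Proof.
move=> oU CF; elim: r => [|i r IHr].
  apply: (Ck_on_ext oU) (Ck_on_cst k U 0) => x _; by rewrite big_nil.
by apply: (Ck_on_ext oU) (Ck_onD oU (CF i) IHr) => x _; rewrite big_cons.
Qed.

Lemma smooth_on_differentiable U f x : smooth_on U f -> U x -> differentiable f x.
Proof. by move=> /(_ 1%N)[df _]; exact: df. Qed.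

Lemma smooth_on_derive U f v : smooth_on U f -> smooth_on U ('D_v f).
Proof. by move=> sf k; have [_ /(_ v)] := sf k.+1. Qed.

End Ck.

Section CkReal.
Context {R : realType} {V : normedModType R}.
Implicit Types (U : set V) (f g : V -> R) (k : nat).

Lemma Ck_onM k U f g : open U ->
  Ck_on k U f -> Ck_on k U g -> Ck_on k U (fun x => f x * g x).
Proof.
move=> oU; elim: k f g => [|k IHk] f g.
  by move=> Cf Cg x Ux; apply: continuousM; [exact: Cf|exact: Cg].
move=> Cf Cg; have [df Cf'] := Cf; have [dg Cg'] := Cg; split=> [x Ux|v].
  by apply: differentiableM; [exact: df|exact: dg].
apply: (Ck_on_ext oU) (Ck_onD oU (IHk _ _ (Ck_onW Cf) (Cg' v)) (IHk _ _ (Ck_onW Cg) (Cf' v))).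
move=> x Ux /=; rewrite deriveM //; apply: diff_derivable; [exact: df|exact: dg].
Qed.

Lemma Ck_onZl (W : normedModType R) k U f (w : W) : open U ->
  Ck_on k U f -> Ck_on k U (fun x => f x *: w).
Proof.
move=> oU; elim: k f => [|k IHk] f.
  by move=> Cf x Ux; apply: continuousZ; [exact: Cf|exact: cst_continuous].
move=> [df Cf]; split=> [x Ux|v]; first exact: differentiableZl (df x Ux).
apply: (Ck_on_ext oU) (IHk _ (Cf v)) => x Ux.
rewrite [RHS]deriveE; last exact: differentiableZl (df x Ux).
by rewrite diffZl ?deriveE //; exact: df.
Qed.

Lemma Ck_on_coord m n k U (f : V -> 'M[R]_(m, n)) i j : open U ->
  Ck_on k U f -> Ck_on k U (fun x => f x i j).
Proof.
move=> oU; elim: k f => [|k IHk] f.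
  move=> Cf x Ux; apply: (@continuous_comp _ _ _ f (fun M : 'M[R]_(m, n) => M i j) x (Cf x Ux)).
  exact: coord_continuous.
move=> [df Cf]; split=> [x Ux|v].
  exact: (differentiable_comp (df x Ux) (differentiable_coord _ _ _)).
apply: (Ck_on_ext oU) (IHk _ (Cf v)) => x Ux.
by rewrite derive_mx ?mxE //; exact/diff_derivable/df.
Qed.

Lemma Ck_on_row n k U (f : V -> 'rV[R]_n) : open U ->
  (forall j, Ck_on k U (fun x => f x 0 j)) -> Ck_on k U f.
Proof.
move=> oU Cf.
apply: (Ck_on_ext oU) (Ck_on_sum (index_enum 'I_n) oU
  (fun j => Ck_onZl (delta_mx 0 j) oU (Cf j))).
by move=> x _; rewrite [RHS]row_sum_delta.
Qed.

End CkReal.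

Section Comp.
Context {R : realType} {V : normedModType R}.

(** The hypothesis says that [a] has constant differential [L], so the derivative of [f \o a] along
    [v] is that of [f] along [L v], again composed with [a]. The use is for slices of a product. *)
Lemma Ck_on_precomp (V' W : normedModType R) k (U : set V) (f : V -> W)
    (a : V' -> V) (L : V' -> V) : open U ->
  (forall x, differentiable a x) -> (forall x v, 'd a x v = L v) ->
  Ck_on k U f -> Ck_on k (a @^-1` U) (f \o a).
Proof.
move=> oU da aL.
have oaU : open (a @^-1` U).
  by apply: open_comp => // x _; exact/differentiable_continuous.
elim: k f => [|k IHk] f.
  move=> Cf x Ux; apply: continuous_comp; last exact: Cf.
  exact/differentiable_continuous.
move=> [df Cf]; split=> [x Ux|v]; first by apply: differentiable_comp => //; exact: df.
apply: (Ck_on_ext oaU) (IHk _ (Cf (L v))) => x Ux.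
rewrite [RHS]deriveE; last by apply: differentiable_comp => //; exact: df.
rewrite diff_comp //=; last exact: df.
by rewrite aL deriveE //; exact: df.
Qed.

End Comp.

(** * Symmetry of second derivatives *)

Section Schwarz.
Context {R : realType} {V : normedModType R}.

Lemma MVT_line (f : V -> R) (p u : V) (h : R) : 0 <= h ->
  (forall t, 0 <= t <= h -> differentiable f (p + t *: u)) ->
  exists2 c, 0 <= c <= h & f (p + h *: u) - f p = h * 'D_u f (p + c *: u).
Proof.
move=> h0 df; pose l (t : R) := p + t *: u.
have dl t : is_diff t l (fun s => s *: u).
  apply: is_diff_eq; by rewrite add0r.
have [||c] := @MVT_segment R (f \o l) (fun t => 'D_u f (l t)) 0 h h0.
- move=> t /itvP tP; have dft : differentiable f (l t) by apply: df; rewrite !tP.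
  have dfl : differentiable (f \o l) t by apply: differentiable_comp.
  apply: DeriveDef; first exact: diff_derivable.
  rewrite deriveE // diff_comp //= diff_val scale1r deriveE //.
- apply: continuous_in_subspaceT => t; rewrite inE /= => /itvP tP.
  apply: differentiable_continuous; apply: differentiable_comp => //.
  by apply: df; rewrite !tP.
move=> /itvP cP E; exists c; first by rewrite !cP.
by move: E; rewrite /= /l scale0r addr0 subr0 mulrC.
Qed.

(** The mean value theorem, first for the increment [g] along [v], then for the derivative of [f]
    along [w]. *)
Lemma second_difference (U : set V) (f : V -> R) (x v w : V) (h : R) : 0 <= h ->
  smooth_on U f -> (forall s t, 0 <= s <= h -> 0 <= t <= h -> U (x + s *: v + t *: w)) ->
  exists s t, [/\ 0 <= s <= h, 0 <= t <= h &
    f (x + h *: v + h *: w) - f (x + h *: v) - (f (x + h *: w) - f x)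
    = h * (h * 'D_w ('D_v f) (x + s *: v + t *: w))].
Proof.
move=> h0 sf Ust.
have h00 : 0 <= (0 : R) <= h by rewrite lexx.
have hh : 0 <= h <= h by rewrite h0 lexx.
pose g y := f (y + h *: w) - f y.
have dsh y : differentiable (fun y : V => y + h *: w) y by [].
have dg t : 0 <= t <= h -> differentiable g (x + t *: v) /\
    'D_v g (x + t *: v) = 'D_v f (x + t *: v + h *: w) - 'D_v f (x + t *: v).
  move=> th; have U1 := Ust t h th hh; have := Ust t 0 th h00.
  rewrite scale0r addr0 => U0.
  have d1 := smooth_on_differentiable sf U1; have d0 := smooth_on_differentiable sf U0.
  have d1' : differentiable (fun y => f (y + h *: w)) (x + t *: v).
    exact: (@differentiable_comp _ _ _ _ (fun y => y + h *: w) f).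
  split; first exact: differentiableB.
  rewrite (_ : g = (fun y => f (y + h *: w)) - f) //.
  rewrite deriveB; [|exact: diff_derivable..].
  congr (_ - _); rewrite [LHS]deriveE // deriveE //.
  rewrite (_ : (fun y => f (y + h *: w)) = f \o (fun y => y + h *: w)) //.
  rewrite diff_comp //=; congr ('d _ _ _).
  have -> : 'd (fun y : V => y + h *: w) (x + t *: v) = (id : V -> V) :> (V -> V).
    by rewrite diff_val; apply/funext => y; rewrite fctE /= addr0.
  by [].
have [s sh gE] := @MVT_line g x v h h0 (fun t th => (dg t th).1).
have [|t th E] := @MVT_line ('D_v f) (x + s *: v) w h h0.
  move=> t th; exact: smooth_on_differentiable (smooth_on_derive v sf) (Ust s t sh th).
exists s, t; split=> //; rewrite -E -(dg s sh).2 -gE /g.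
by [].
Qed.

(** The second difference is symmetric in [v] and [w], so both mixed derivatives take a common value
    at points arbitrarily near [x], and both are continuous. *)
Lemma derive_swap (U : set V) (f : V -> R) (x v w : V) : open U -> U x ->
  smooth_on U f -> 'D_v ('D_w f) x = 'D_w ('D_v f) x.
Proof.
move=> oU Ux sf; apply/eqP; rewrite -subr_eq0 -normr_le0; apply/ler_addgt0Pr => e e0.
rewrite add0r; pose G := 'D_v ('D_w f); pose H := 'D_w ('D_v f).
have cont (k : V -> R) : smooth_on U k -> \forall y \near x, `|k x - k y| < e / 2.
  move=> sk; have := sk 0%N x Ux; move=> /cvgrPdist_lt; apply; exact: divr_gt0.
have nG := cont G (smooth_on_derive v (smooth_on_derive w sf)).
have nH := cont H (smooth_on_derive w (smooth_on_derive v sf)).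
have nU : nbhs x U by exact: open_nbhs_nbhs.
have : nbhs x (U `&` ([set y | `|G x - G y| < e / 2] `&` [set y | `|H x - H y| < e / 2])).
  exact: (filterI nU (filterI nG nH)).
move=> /nbhs_ballP[d /= d0 dP].
(* Small enough to keep the parallelogram on [h *: v] and [h *: w] inside the ball; the added 1
   keeps the denominator positive when [v] and [w] are zero. *)
pose h := d / (2 * (`|v| + `|w| + 1)).
have N0 : 0 < 2 * (`|v| + `|w| + 1) by rewrite mulr_gt0 // ltr_wpDl // addr_ge0.
have h0 : 0 < h by rewrite divr_gt0.
have hP s t : 0 <= s <= h -> 0 <= t <= h -> ball x d (x + s *: v + t *: w).
  move=> /andP[s0 sh] /andP[t0 th]; rewrite -ball_normE /= -addrA opprD addrA subrr sub0r normrN.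
  apply: le_lt_trans (ler_normD _ _) _; rewrite !normrZ !ger0_norm //.
  apply: (@le_lt_trans _ _ (h * (`|v| + `|w|))).
    by rewrite mulrDr lerD // ler_wpM2r.
  rewrite /h mulrAC ltr_pdivrMr // ltr_pM2l //.
  rewrite mulrDr mulr1 mulr2n mulrDl mul1r.
  have := normr_ge0 v; have := normr_ge0 w; lra.
have [s [t [sh th E1]]] := second_difference (ltW h0) sf
  (fun s t sh th => (dP _ (hP s t sh th)).1).
have hP' s' t' : 0 <= s' <= h -> 0 <= t' <= h -> ball x d (x + s' *: w + t' *: v).
  by move=> s'h t'h; rewrite addrAC; exact: hP.
have [s' [t' [s'h t'h E2]]] := second_difference (ltW h0) sf
  (fun s t sh th => (dP _ (hP' s t sh th)).1).
have GH : G (x + s' *: w + t' *: v) = H (x + s *: v + t *: w).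
  apply: (mulfI (lt0r_neq0 h0)); apply: (mulfI (lt0r_neq0 h0)).
  apply: (etrans (esym E2)); apply: (etrans _ E1).
  have swap (a b c k : R) : a - b - (c - k) = a - c - (b - k) by ring.
  by rewrite [x + h *: w + _]addrAC; exact: swap.
have [_ [G1 _]] := dP _ (hP' s' t' s'h t'h).
have [_ [_ H1]] := dP _ (hP s t sh th).
rewrite (_ : _ - _ = (G x - G (x + s' *: w + t' *: v))
                     - (H x - H (x + s *: v + t *: w))); last first.
  have cancel (a b c : R) : a - b = a - c - (b - c) by ring.
  by rewrite GH; exact: cancel.
apply: le_trans (ler_normB _ _) _; rewrite [leRHS]splitr; exact: lerD (ltW G1) (ltW H1).
Qed.

End Schwarz.

(** * Brackets of vector fields related by a smooth map *)

Section Related.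
Context {R : realType} {V : normedModType R} {n : nat}.
Variables (U : set V) (F : V -> 'rV[R]_n) (x : V).
Hypotheses (oU : open U) (Ux : U x) (sF : smooth_on U F).

Let Fc j y := F y 0 j.

Let sFc j : smooth_on U (Fc j).
Proof. by move=> k; exact: Ck_on_coord. Qed.

Let diffFc y v j : U y -> ('d F y v) 0 j = 'D_v (Fc j) y.
Proof.
move=> Uy; have dF := smooth_on_differentiable sF Uy.
by rewrite -deriveE // derive_mx ?mxE //; exact: diff_derivable.
Qed.

(** The relation between the fields, differentiated along [h]. The upper field is written with
    constant vectors [b i] and scalar coefficients [a i], so that only products of scalar functions
    are differentiated. *)
Lemma diff_related m (b : 'I_m -> V) (a : 'I_m -> V -> R) (Y : 'rV[R]_n -> 'rV[R]_n) h j :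
  (forall i, differentiable (a i) x) -> differentiable Y (F x) ->
  (forall y, U y -> Y (F y) = 'd F y (\sum_i a i y *: b i)) ->
  ('d Y (F x) ('d F x h)) 0 j = ('d F x (\sum_i 'd (a i) x h *: b i)) 0 j
    + \sum_i a i x * 'D_h ('D_(b i) (Fc j)) x.
Proof.
move=> da dY rel; have dF := smooth_on_differentiable sF Ux.
pose G y := \sum_i a i y * 'D_(b i) (Fc j) y.
have GE : {near x, (fun y => (Y \o F) y 0 j) =1 G}.
  have nU : nbhs x U by exact: open_nbhs_nbhs.
  apply: filterS nU => y Uy /=; rewrite rel // linear_sum summxE; apply: eq_bigr => i _.
  by rewrite linearZ mxE diffFc.
have dDF i : differentiable ('D_(b i) (Fc j)) x.
  exact: smooth_on_differentiable (smooth_on_derive (b i) (sFc j)) Ux.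
have dYF : differentiable (Y \o F) x by exact: differentiable_comp.
transitivity ('D_h (fun y => (Y \o F) y 0 j) x).
  transitivity (('D_h (Y \o F) x) 0 j); last first.
    by rewrite derive_mx ?mxE //; exact: diff_derivable.
  rewrite [in RHS]deriveE; last exact: dYF. 
  have E := diff_comp dF dY.
  exact: (congr1 (fun g : V -> 'rV[R]_n => g h 0 j) (esym E)).
rewrite (near_eq_derive _ GE) /G.
rewrite (_ : (fun y => _) = \sum_i (a i * 'D_(b i) (Fc j) : V -> R)); last first.
  by apply/funext => y; rewrite fct_sumE.
rewrite derive_sum; last by move=> i; exact/diff_derivable/differentiableM.
rewrite linear_sum summxE -big_split; apply: eq_bigr => i _.
rewrite deriveM; [|exact: diff_derivable..].
rewrite linearZ mxE (diffFc _ _ Ux) (deriveE h (da i)) [RHS]addrC.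
congr (_ + _); exact: mulrC.
Qed.

(* If [Y] and [Y'] are [F]-related to [X] and [X'], then so are their brackets:
   the second derivatives of [F] cancel by symmetry. *)
Lemma related_bracket m m' (b : 'I_m -> V) (b' : 'I_m' -> V)
    (a : 'I_m -> V -> R) (a' : 'I_m' -> V -> R) (Y Y' : 'rV[R]_n -> 'rV[R]_n) :
  (forall i, differentiable (a i) x) -> (forall i, differentiable (a' i) x) ->
  differentiable Y (F x) -> differentiable Y' (F x) ->
  (forall y, U y -> Y (F y) = 'd F y (\sum_i a i y *: b i)) ->
  (forall y, U y -> Y' (F y) = 'd F y (\sum_i a' i y *: b' i)) ->
  'd Y' (F x) (Y (F x)) - 'd Y (F x) (Y' (F x))
  = 'd F x (\sum_i 'd (a' i) x (\sum_i a i x *: b i) *: b' i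
            - \sum_i 'd (a i) x (\sum_i a' i x *: b' i) *: b i).
Proof.
move=> da da' dY dY' rel rel'; apply/rowP => j.
rewrite linearB /= [LHS]mxE [RHS]mxE [X in _ + X]mxE [X in _ = _ + X]mxE.
rewrite (rel x Ux) (rel' x Ux).
rewrite (diff_related _ _ da' dY' rel') (diff_related _ _ da dY rel).
have E m1 m2 (c : 'I_m1 -> V) (e : 'I_m1 -> V -> R) (c' : 'I_m2 -> V) (e' : 'I_m2 -> V -> R) :
    \sum_i e i x * 'D_(\sum_k e' k x *: c' k) ('D_(c i) (Fc j)) x
    = \sum_i \sum_k e i x * (e' k x * 'D_(c' k) ('D_(c i) (Fc j)) x).
  apply: eq_bigr => i _; rewrite -mulr_sumr; congr (_ * _).
  have dD := smooth_on_differentiable (smooth_on_derive (c i) (sFc j)) Ux.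
  rewrite deriveE // linear_sum; apply: eq_bigr => k _.
  by rewrite linearZ deriveE.
rewrite !E [X in _ + X - _]exchange_big /=.
rewrite [X in _ + X - _](eq_bigr (fun k =>
  \sum_i a k x * (a' i x * 'D_(b' i) ('D_(b k) (Fc j)) x))).
  have cancel (p q r : R) : p + r - (q + r) = p - q by ring.
  exact: cancel.
move=> k _; apply: eq_bigr => i _.
have sw := derive_swap (b k) (b' i) oU Ux (sFc j).
exact: (etrans (congr1 (fun z => a' i x * (a k x * z)) sw) (mulrCA _ _ _)).
Qed.

End Related.

Section LocallyConstant.
Context {R : realType} {V : normedModType R}.

Lemma diff0_near_cst (U : set V) (f : V -> R) x : open U -> U x ->
  (forall y, U y -> differentiable f y) ->
  (forall y v, U y -> 'd f y v = 0) -> \forall y \near x, f y = f x.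
Proof.
move=> oU Ux df df0; have nU : nbhs x U by exact: open_nbhs_nbhs.
have /nbhs_ballP[d /= d0 dU] := nU; apply/nbhs_ballP; exists d => //= y xy.
have seg t : 0 <= t <= 1 -> U (x + t *: (y - x)).
  move=> /andP[t0 t1]; apply: dU; move: xy.
  rewrite -!ball_normE /= opprD addrA subrr sub0r normrN normrZ ger0_norm //.
  by rewrite -normrN opprB; apply: le_lt_trans; rewrite ler_piMl.
have [|c c01 E] := @MVT_line R V f x (y - x) 1 ler01; first by move=> t /seg/df.
have Uc := seg c c01.
move: E; rewrite scale1r addrCA subrr addr0 deriveE; last exact: df.
by rewrite df0 // mulr0 => /eqP; rewrite subr_eq0 => /eqP.
Qed.

End LocallyConstant.

(** * Charts, functions and fields *)

Section Manifold.
Context {R : realType} {n : nat} {M : topologicalType}.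
Variable A : smooth_manifold R n M.
Notation dom := (dom A).
Notation chart := (chart A).
Notation chart_inv := (chart_inv A).
Notation chart_at := (chart_at A).
Notation pt_coord := (pt_coord A).
Notation loc := (loc A).
Notation img i := (chart i @` dom i).

Lemma img_chart i p : dom i p -> img i (chart i p).
Proof. by move=> dp; exists p. Qed.

Lemma chart_invK i y : img i y -> chart i (chart_inv i y) = y.
Proof. by move=> [p dp <-]; rewrite chartK. Qed.

Lemma dom_chart_inv i y : img i y -> dom i (chart_inv i y).
Proof. by move=> [p dp <-]; rewrite chartK. Qed.

Lemma img_pt p : img (chart_at p) (pt_coord p).
Proof. exact: img_chart (chart_at_dom A p). Qed.

Lemma locK p : loc p (pt_coord p) = p.
Proof. exact: chartK (chart_at_dom A p). Qed.

Lemma continuous_chart_inv i p : dom i p -> {for chart i p, continuous (chart_inv i)}.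
Proof. by move=> dp; apply: chart_inv_continuous; exact: img_chart. Qed.

Lemma near_dom (T : topologicalType) (phi : T -> M) y j :
  {for y, continuous phi} -> dom j (phi y) -> \forall z \near y, dom j (phi z).
Proof.
by move=> cphi dj; apply: cphi; apply: open_nbhs_nbhs; split => //; exact: dom_open.
Qed.

Section Chain.
Context {V W : normedModType R}.
Variables (phi : V -> M) (y : V) (j : chart_index A) (h : M -> W).
Hypotheses (cphi : {for y, continuous phi}) (dj : dom j (phi y)).
Hypothesis dphi : differentiable (chart j \o phi) y.
Hypothesis dh : differentiable (h \o chart_inv j) (chart j (phi y)).

Let nearE : {near y, (h \o chart_inv j) \o (chart j \o phi) =1 h \o phi}.
Proof. by apply: filterS (near_dom cphi dj) => z dz /=; rewrite chartK. Qed.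

Lemma diff_chain v :
  'd (h \o phi) y v = 'd (h \o chart_inv j) (chart j (phi y)) ('d (chart j \o phi) y v).
Proof.
by have [_ ->] := near_eq_diff nearE (differentiable_comp dphi dh); rewrite diff_comp.
Qed.

End Chain.

(** Differentiability at one point, in all charts: enough for the chain rule of [tangent_map], and
    directly available for translations. *)
Definition chart_diff (F : M -> M) (p : M) :=
  {for p, continuous F} /\
  forall i j, dom i p -> dom j (F p) ->
    differentiable (chart j \o F \o chart_inv i) (chart i p).

Lemma chart_diff_id p : chart_diff id p.
Proof.
split=> [|i j di dj]; first exact: cvg_id.
apply: (smooth_on_differentiable (transition_smooth i j)).
by exists p.
Qed.

Lemma continuous_comp_chart_inv (F : M -> M) i p : {for p, continuous F} -> dom i p ->
  {for chart i p, continuous (F \o chart_inv i)}.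
Proof.
move=> cF di; apply: continuous_comp; first exact: continuous_chart_inv.
by rewrite chartK.
Qed.

Lemma diff_chart_chain (W : normedModType R) (h : M -> W) (F : M -> M) i j p v :
  chart_diff F p -> dom i p -> dom j (F p) ->
  differentiable (h \o chart_inv j) (chart j (F p)) ->
  'd (h \o F \o chart_inv i) (chart i p) v
  = 'd (h \o chart_inv j) (chart j (F p)) ('d (chart j \o F \o chart_inv i) (chart i p) v).
Proof.
move=> [cF dF] di dj dh.
have := @diff_chain _ _ (F \o chart_inv i) (chart i p) j h.
rewrite /= chartK //; apply => //; first exact: continuous_comp_chart_inv.
exact: dF.
Qed.

Lemma tangent_map_comp F G p v : chart_diff G p -> chart_diff F (G p) ->
  tangent_map A (F \o G) p v = tangent_map A F (G p) (tangent_map A G p v).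
Proof.
move=> dG [cF dF]; rewrite /tangent_map.
have := @diff_chart_chain _ (chart (chart_at (F (G p))) \o F) G (chart_at p)
  (chart_at (G p)) p v dG.
apply; [exact: chart_at_dom|exact: chart_at_dom|].
by apply: dF; exact: chart_at_dom.
Qed.

Lemma diff_chart_inv_id i p v : dom i p ->
  'd (chart i \o chart_inv i) (chart i p) v = v.
Proof.
move=> di; have E : {near chart i p, id =1 chart i \o chart_inv i}.
  apply: (@filterS _ _ _ (img i)) => [y yi|]; first by rewrite /= chart_invK.
  by apply: open_nbhs_nbhs; split; [exact: img_open|exact: img_chart].
have did : differentiable (id : 'rV[R]_n -> 'rV[R]_n) (chart i p) by [].
have [_ ->] := near_eq_diff E did.
by rewrite diff_val.
Qed.

Lemma tangent_map_id p v : tangent_map A id p v = v.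
Proof. exact: diff_chart_inv_id (chart_at_dom A p). Qed.

Lemma of_chartK i p v : dom i p -> to_chart i p (of_chart i p v) = v.
Proof.
move=> di; rewrite -[RHS](diff_chart_inv_id v di); symmetry.
apply: (@diff_chart_chain _ (chart i) id i (chart_at p) p v (chart_diff_id p) di).
  exact: chart_at_dom.
exact: ((chart_diff_id p).2 _ _ (chart_at_dom A p) di).
Qed.

Lemma to_chartK i p v : dom i p -> of_chart i p (to_chart i p v) = v.
Proof.
move=> di; rewrite -[RHS](diff_chart_inv_id v (chart_at_dom A p)); symmetry.
apply: (@diff_chart_chain _ (chart (chart_at p)) id (chart_at p) i p v (chart_diff_id p) _ di).
  exact: chart_at_dom.
exact: ((chart_diff_id p).2 _ _ di (chart_at_dom A p)).
Qed.

Lemma to_chart_at p v : to_chart (chart_at p) p v = v.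
Proof. exact: diff_chart_inv_id (chart_at_dom A p). Qed.

(** [tangent_map] uses the preferred charts, which may jump from point to point; smoothness can be
    tested only after passing to fixed charts. *)
Lemma to_chart_tangent_map F i j p v : chart_diff F p -> dom i p -> dom j (F p) ->
  to_chart j (F p) (tangent_map A F p v)
  = 'd (chart j \o F \o chart_inv i) (chart i p) (to_chart i p v).
Proof.
move=> dF di dj; transitivity ('d (chart j \o F \o loc p) (pt_coord p) v).
  rewrite /to_chart /tangent_map.
  symmetry; apply: (diff_chart_chain _ dF) => //; try exact: chart_at_dom.
  apply: (chart_diff_id (F p)).2 => //; exact: chart_at_dom.
apply: (@diff_chart_chain _ (chart j \o F) id) => //.
- exact: chart_diff_id.
- exact: chart_at_dom.
- exact: dF.2.
Qed.

Lemma vfield_coord_pt X p : vfield_coord X (chart_at p) (pt_coord p) = X p.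
Proof. by rewrite /vfield_coord -/(loc p (pt_coord p)) locK to_chart_at. Qed.

Lemma smooth_fun_differentiable f i p : smooth_fun A f -> dom i p ->
  differentiable (f \o chart_inv i) (chart i p).
Proof. by move=> sf di; apply: (smooth_on_differentiable (sf i)); exact: img_chart. Qed.

Lemma dfunE f i p v : smooth_fun A f -> dom i p ->
  dfun A f p v = 'd (f \o chart_inv i) (chart i p) (to_chart i p v).
Proof.
move=> sf di; apply: (@diff_chart_chain _ f id) => //.
- exact: chart_diff_id.
- exact: chart_at_dom.
- exact: smooth_fun_differentiable.
Qed.

End Manifold.

Section Fields.
Context {R : realType} {n : nat} {M : topologicalType}.
Variable A : smooth_manifold R n M.
Notation dom := (dom A).
Notation chart := (chart A).
Notation chart_inv := (chart_inv A).
Notation chart_at := (chart_at A).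
Notation pt_coord := (pt_coord A).
Notation img i := (chart i @` dom i).
Implicit Types (f : M -> R) (X Y : M -> 'rV[R]_n) (i : chart_index A).

Lemma smooth_fun_cst c : smooth_fun A (fun=> c).
Proof. by move=> i k; exact: Ck_on_cst. Qed.

Lemma smooth_funD f f' : smooth_fun A f -> smooth_fun A f' ->
  smooth_fun A (fun q => f q + f' q).
Proof. by move=> sf sf' i k; apply: Ck_onD (sf i k) (sf' i k); exact: img_open. Qed.

Lemma smooth_funM f f' : smooth_fun A f -> smooth_fun A f' ->
  smooth_fun A (fun q => f q * f' q).
Proof. by move=> sf sf' i k; apply: Ck_onM (sf i k) (sf' i k); exact: img_open. Qed.

Lemma smooth_fun_sum (I : Type) (r : seq I) (F : I -> M -> R) :
  (forall a, smooth_fun A (F a)) -> smooth_fun A (fun q => \sum_(a <- r) F a q).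
Proof.
move=> sF i k.
exact: (Ck_on_sum r (@img_open _ _ _ _ i) (fun a => sF a i k)).
Qed.

Lemma smooth_fun_pt f p : smooth_fun A f ->
  differentiable (f \o loc A p) (pt_coord p).
Proof. by move=> sf; exact: smooth_fun_differentiable sf (chart_at_dom A p). Qed.

Lemma dfun_cst c p v : dfun A (fun=> c) p v = 0.
Proof.
rewrite /dfun (_ : _ \o _ = cst c) //.
by rewrite diff_cst.
Qed.

Lemma dfunD f f' p v : smooth_fun A f -> smooth_fun A f' ->
  dfun A (fun q => f q + f' q) p v = dfun A f p v + dfun A f' p v.
Proof.
move=> sf sf'; rewrite /dfun.
have := diffD (smooth_fun_pt p sf) (smooth_fun_pt p sf').
by move=> /(congr1 (fun g => g v)).
Qed.

Lemma dfunM f f' p v : smooth_fun A f -> smooth_fun A f' ->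
  dfun A (fun q => f q * f' q) p v = f p * dfun A f' p v + f' p * dfun A f p v.
Proof.
move=> sf sf'; rewrite /dfun.
have := diffM (smooth_fun_pt p sf) (smooth_fun_pt p sf').
move=> /(congr1 (fun g => g v)) /=; rewrite locK.
exact.
Qed.

Lemma dfun_sum (I : Type) (r : seq I) (F : I -> M -> R) p v :
  (forall a, smooth_fun A (F a)) ->
  dfun A (fun q => \sum_(a <- r) F a q) p v = \sum_(a <- r) dfun A (F a) p v.
Proof.
move=> sF; elim: r => [|a r IHr].
  rewrite big_nil (_ : (fun _ => _) = fun=> 0) ?dfun_cst //.
  by apply/funext => q; rewrite big_nil.
rewrite big_cons -IHr -dfunD //; last exact: smooth_fun_sum.
by congr (dfun A _ p v); apply/funext => q; rewrite big_cons.
Qed.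

Lemma vfield_coordD X Y i :
  vfield_coord (fun q => X q + Y q) i = vfield_coord X i \+ vfield_coord Y i.
Proof. apply/funext => y. exact: raddfD. Qed.

Lemma vfield_coordZ f X i y :
  vfield_coord (fun q => f q *: X q) i y = f (chart_inv i y) *: vfield_coord X i y.
Proof. by rewrite /vfield_coord /to_chart linearZ. Qed.

Lemma smooth_vfieldD X Y : smooth_vfield A X -> smooth_vfield A Y ->
  smooth_vfield A (fun q => X q + Y q).
Proof.
move=> sX sY i k; rewrite vfield_coordD.
by apply: Ck_onD (sX i k) (sY i k); exact: img_open.
Qed.

Lemma smooth_vfieldZ f X : smooth_fun A f -> smooth_vfield A X ->
  smooth_vfield A (fun q => f q *: X q).
Proof.
move=> sf sX i k; have oi := @img_open _ _ _ _ i; apply: Ck_on_row => // j.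
apply: (Ck_on_ext oi _ (Ck_onM oi (sf i k) (Ck_on_coord 0 j oi (sX i k)))).
by move=> y _; rewrite vfield_coordZ mxE.
Qed.

Lemma smooth_vfield0 : smooth_vfield A (fun=> 0).
Proof.
move=> i k; apply: (Ck_on_ext (@img_open _ _ _ _ i) _ (Ck_on_cst k _ 0)).
by move=> y _; rewrite /vfield_coord /to_chart linear0.
Qed.

Lemma smooth_vfield_sum (I : Type) (r : seq I) (F : I -> M -> 'rV[R]_n) :
  (forall a, smooth_vfield A (F a)) ->
  smooth_vfield A (fun q => \sum_(a <- r) F a q).
Proof.
move=> sF; elim: r => [|a r IHr].
  rewrite (_ : (fun _ => _) = fun=> 0); first exact: smooth_vfield0.
  by apply/funext => q; rewrite big_nil.
rewrite (_ : (fun _ => _) = fun q => F a q + \sum_(b <- r) F b q).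
  exact: smooth_vfieldD.
by apply/funext => q; rewrite big_cons.
Qed.

Lemma tensor_app_sum (S : M -> 'M[R]_n) p (I J : Type) (r : seq I) (s : seq J)
    (a : I -> R) (b : J -> R) (u : I -> 'rV[R]_n) (v : J -> 'rV[R]_n) :
  tensor_app S p (\sum_(i <- r) a i *: u i) (\sum_(j <- s) b j *: v j)
  = \sum_(i <- r) \sum_(j <- s) a i * b j * tensor_app S p (u i) (v j).
Proof.
rewrite /tensor_app !mulmx_suml summxE; apply: eq_bigr => i _.
rewrite linear_sum mulmx_sumr summxE; apply: eq_bigr => j _.
by rewrite linearZ /= -scalemxAr -!scalemxAl !mxE mulrCA mulrA.
Qed.

(** [smooth_tensor] tests [S] on coordinate fields of a chart only, so [X] and [Y] are expanded in
    these with smooth coefficients. *)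
Lemma smooth_tensor_app S X Y : smooth_tensor A S -> smooth_vfield A X ->
  smooth_vfield A Y -> smooth_fun A (fun q => tensor_app S q (X q) (Y q)).
Proof.
move=> sS sX sY i k; have oi := @img_open _ _ _ _ i.
pose c (a b : 'I_n) y := vfield_coord X i y 0 a * vfield_coord Y i y 0 b *
  tensor_app S (chart_inv i y) (of_chart i (chart_inv i y) (delta_mx 0 a))
                               (of_chart i (chart_inv i y) (delta_mx 0 b)).
have sc a b : Ck_on k (img i) (c a b).
  apply: Ck_onM (sS i _ _ k) => //.
  by apply: Ck_onM => //; apply: Ck_on_coord => //; [exact: sX|exact: sY].
apply: (Ck_on_ext oi _ (Ck_on_sum (index_enum 'I_n) oi
  (fun a => Ck_on_sum (index_enum 'I_n) oi (sc a)))) => y iy /=.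
have di := dom_chart_inv iy.
have E Z : Z (chart_inv i y) = \sum_a vfield_coord Z i y 0 a *:
    of_chart i (chart_inv i y) (delta_mx 0 a).
  rewrite -[LHS](to_chartK _ di) -/(vfield_coord Z i y).
  rewrite [X in of_chart _ _ X]row_sum_delta /of_chart linear_sum.
  by apply: eq_bigr => a _; rewrite linearZ.
by rewrite (E X) (E Y) tensor_app_sum.
Qed.

Lemma smooth_vfield_pt X p : smooth_vfield A X ->
  differentiable (vfield_coord X (chart_at p)) (pt_coord p).
Proof. by move=> sX; apply: (smooth_on_differentiable (sX _)); exact: img_pt. Qed.

(** The mean value theorem in a chart makes [f] locally constant, so the level set through [q] is
    open and closed. *)
Lemma dfun0_cst f : connected [set: M] -> smooth_fun A f ->
  (forall p v, dfun A f p v = 0) -> forall p q, f p = f q.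
Proof.
move=> cM sf f0 p q.
have loccst r : \forall s \near r, f s = f r.
  have di := chart_at_dom A r; have oi := @img_open _ _ _ _ (chart_at r).
  have : \forall y \near pt_coord r, (f \o loc A r) y = (f \o loc A r) (pt_coord r).
    apply: (diff0_near_cst oi (img_pt A r)) => [y iy|y v iy].
      exact: (smooth_on_differentiable (sf _) iy).
    have ds := dom_chart_inv iy.
    have := dfunE (of_chart (chart_at r) (loc A r y) v) sf ds.
    have cy : chart (chart_at r) (loc A r y) = y := chart_invK iy.
    by rewrite f0 (of_chartK v ds) cy => <-.
  have cr := chart_continuous di.
  move=> /cr; rewrite /= locK => H.
  near=> s; have <- : loc A r (chart (chart_at r) s) = s.
    by apply: chartK; near: s; apply: open_nbhs_nbhs; split=> //; exact: dom_open.
  by near: s.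
have E := cM [set s | f s = f q].
have : [set s | f s = f q] = setT.
  apply: E; first by exists q.
    exists [set s | f s = f q]; last by rewrite setTI.
    by rewrite openE => s /= sq; apply: filterS (loccst s) => t /= ->.
  exists [set s | f s = f q]; last by rewrite setTI.
  move=> s cs; have [t [/= tq ts]] := cs _ (loccst s).
  by rewrite /= -ts.
by move=> /seteqP[_ /(_ p I)].
Unshelve. all: by end_near. Qed.

End Fields.

(** * Invariant fields on a Lie group *)

Section FactorDiff.
Context {R : realType}.

Lemma diff_coord_comp n (V : normedModType R) (Y : V -> 'rV[R]_n) x v k : differentiable Y x ->
  differentiable (fun y => Y y 0 k) x /\ 'd (fun y => Y y 0 k) x v = ('d Y x v) 0 k.
Proof.
move=> dY.
have dk : differentiable (fun y => Y y 0 k) x.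
  exact: (differentiable_comp dY (differentiable_coord _ 0 k)).
split=> //; rewrite -!deriveE // derive_mx ?mxE //; exact: diff_derivable.
Qed.

Lemma diff_comp_fst (V1 V2 W : normedModType R) (Y : V1 -> W) (x : V1) (y : V2) s t :
  differentiable Y x ->
  differentiable (fun z : V1 * V2 => Y z.1) (x, y) /\
  'd (fun z : V1 * V2 => Y z.1) (x, y) (s, t) = 'd Y x s.
Proof.
move=> dY; have cf : continuous (fst : V1 * V2 -> V1) by move=> z; exact: cvg_fst.
have df := linear_differentiable (x, y) cf.
have E2 := congr1 (fun g => g (s, t)) (diff_lin (x, y) cf).
split; first exact: (differentiable_comp df dY).
apply: etrans (congr1 (fun g => g (s, t)) (diff_comp df dY)) _.
by rewrite /= E2.
Qed.

Lemma diff_comp_snd (V1 V2 W : normedModType R) (Y : V2 -> W) (x : V1) (y : V2) s t :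
  differentiable Y y ->
  differentiable (fun z : V1 * V2 => Y z.2) (x, y) /\
  'd (fun z : V1 * V2 => Y z.2) (x, y) (s, t) = 'd Y y t.
Proof.
move=> dY; have cf : continuous (snd : V1 * V2 -> V2) by move=> z; exact: cvg_snd.
have df := linear_differentiable (x, y) cf.
have E2 := congr1 (fun g => g (s, t)) (diff_lin (x, y) cf).
split; first exact: (differentiable_comp df dY).
apply: etrans (congr1 (fun g => g (s, t)) (diff_comp df dY)) _.
by rewrite /= E2.
Qed.

End FactorDiff.

Section LieGroup.
Context {R : realType} {n : nat} {N : topologicalType}.
Variable G : lie_group R n N.
Notation dom := (dom G).
Notation chart := (chart G).
Notation chart_inv := (chart_inv G).
Notation chart_at := (chart_at G).
Notation pt_coord := (pt_coord G).
Notation loc := (loc G).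
Notation img i := (chart i @` dom i).
Notation mul := (lg_mul G).
Notation "1" := (lg_one G).
Implicit Types (i j k : chart_index G).

Lemma lg_mulrV : right_inverse 1 (lg_inv G) mul.
Proof.
move=> x; rewrite -[LHS](lg_mul1 G) -{1}(lg_mulV G (lg_inv G x)) -(lg_mulA G).
by rewrite (lg_mulA G (lg_inv G x) x) lg_mulV lg_mul1 lg_mulV.
Qed.

Lemma lg_mulr1 : right_id 1 mul.
Proof. by move=> x; rewrite -(lg_mulV G x) (lg_mulA G) lg_mulrV lg_mul1. Qed.

Lemma lg_mul_continuous (x : N * N) : {for x, continuous (fun pq : N * N => mul pq.1 pq.2)}.
Proof. exact: (lg_mul_smooth G).1. Qed.

Definition mul_chart_dom i j k : set ('rV[R]_n * 'rV[R]_n) :=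
  [set (chart i pq.1, chart j pq.2) | pq in
     [set pq : N * N | dom i pq.1 /\ dom j pq.2 /\ dom k (mul pq.1 pq.2)]].

Definition mul_chart i j k (xy : 'rV[R]_n * 'rV[R]_n) : 'rV[R]_n :=
  chart k (mul (chart_inv i xy.1) (chart_inv j xy.2)).

Lemma mul_chart_smooth i j k : smooth_on (mul_chart_dom i j k) (mul_chart i j k).
Proof. exact: (lg_mul_smooth G).2. Qed.

Lemma mul_chart_domP i j k p q : dom i p -> dom j q -> dom k (mul p q) ->
  mul_chart_dom i j k (chart i p, chart j q).
Proof. by move=> dp dq dpq; exists (p, q). Qed.

(** The calculus above works on open sets; here openness comes from the continuity of the
    multiplication. *)
Lemma open_mul_chart_dom i j k : open (mul_chart_dom i j k).
Proof.
rewrite openE => _ [[p q] /= [dp [dq dpq]] <-].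
pose phi (xy : 'rV[R]_n * 'rV[R]_n) := mul (chart_inv i xy.1) (chart_inv j xy.2).
have cphi : {for (chart i p, chart j q), continuous phi}.
  have cp : (chart_inv i xy.1, chart_inv j xy.2) @[xy --> (chart i p, chart j q)]
      --> (p, q).
    have inv_cvg i' r : dom i' r -> chart_inv i' y @[y --> chart i' r] --> r.
      by move=> di; have := continuous_chart_inv di; rewrite /prop_for /continuous_at chartK.
    apply: cvg_pair => /=.
      by apply: cvg_comp (inv_cvg _ _ dp); exact: cvg_fst.
    by apply: cvg_comp (inv_cvg _ _ dq); exact: cvg_snd.
  rewrite /prop_for /continuous_at {2}/phi /= !chartK //.
  have H := @lg_mul_continuous (p, q).
  apply: (@cvg_comp _ _ _ (fun xy : 'rV[R]_n * 'rV[R]_n => (chart_inv i xy.1, chart_inv j xy.2))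
    (fun pq : N * N => mul pq.1 pq.2) _ _ _ cp). exact: H.
have n1 : \forall xy \near (chart i p, chart j q), img i xy.1.
  apply: (@cvg_fst _ _ (nbhs (chart i p)) (nbhs (chart j q))).
  by apply: open_nbhs_nbhs; split; [exact: img_open|exact: img_chart].
have n2 : \forall xy \near (chart i p, chart j q), img j xy.2.
  apply: (@cvg_snd _ _ (nbhs (chart i p)) (nbhs (chart j q))).
  by apply: open_nbhs_nbhs; split; [exact: img_open|exact: img_chart].
have n3 : \forall xy \near (chart i p, chart j q), dom k (phi xy).
  by apply: near_dom cphi _; rewrite /phi /= !chartK.
apply: filterS3 n1 n2 n3 => -[x y] /= ix iy dxy.
rewrite -(chart_invK ix) -(chart_invK iy).
by apply: mul_chart_domP => //; exact: dom_chart_inv.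
Qed.

Lemma mul_chart_diff i j k xy : mul_chart_dom i j k xy -> differentiable (mul_chart i j k) xy.
Proof. exact: smooth_on_differentiable (@mul_chart_smooth i j k). Qed.

Lemma diff_pair_right (x y u : 'rV[R]_n) :
  differentiable (fun z : 'rV[R]_n => (x, z)) y /\
  'd (fun z : 'rV[R]_n => (x, z)) y u = (0, u).
Proof.
have D1 : differentiable (fun=> x : 'rV[R]_n) y by exact: differentiable_cst.
have D2 : differentiable (id : 'rV[R]_n -> 'rV[R]_n) y by [].
split; first exact: (differentiable_pair D1 D2).
apply: etrans (congr1 (fun g => g u) (diff_pair D1 D2)) _.
congr (_, _); last by rewrite diff_val.
exact: (congr1 (fun g => g u) (diff_cst _ _)).
Qed.

Lemma diff_pair_left (y x u : 'rV[R]_n) :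
  differentiable (fun z : 'rV[R]_n => (z, y)) x /\
  'd (fun z : 'rV[R]_n => (z, y)) x u = (u, 0).
Proof.
have D1 : differentiable (fun=> y : 'rV[R]_n) x by exact: differentiable_cst.
have D2 : differentiable (id : 'rV[R]_n -> 'rV[R]_n) x by [].
split; first exact: (differentiable_pair D2 D1).
apply: etrans (congr1 (fun g => g u) (diff_pair D2 D1)) _.
congr (_, _); first by rewrite diff_val.
exact: (congr1 (fun g => g u) (diff_cst _ _)).
Qed.

Lemma diff_mul_chart_right i j k p q u : dom i p -> dom j q -> dom k (mul p q) ->
  differentiable (chart k \o mul p \o chart_inv j) (chart j q) /\
  'd (mul_chart i j k) (chart i p, chart j q) (0, u)
  = 'd (chart k \o mul p \o chart_inv j) (chart j q) u.
Proof.
move=> dp dq dpq; have dF := mul_chart_diff (mul_chart_domP dp dq dpq).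
have [da aE] := diff_pair_right (chart i p) (chart j q) u.
have E : chart k \o mul p \o chart_inv j = mul_chart i j k \o (fun z => (chart i p, z)).
  by apply/funext => z; rewrite /mul_chart /= chartK.
rewrite E; split; first exact: (differentiable_comp da dF).
apply: esym; apply: etrans (congr1 (fun g => g u) (diff_comp da dF)) _.
by rewrite /= aE.
Qed.

Lemma diff_mul_chart_left i j k p q u : dom i p -> dom j q -> dom k (mul p q) ->
  differentiable (chart k \o mul^~ q \o chart_inv i) (chart i p) /\
  'd (mul_chart i j k) (chart i p, chart j q) (u, 0)
  = 'd (chart k \o mul^~ q \o chart_inv i) (chart i p) u.
Proof.
move=> dp dq dpq; have dF := mul_chart_diff (mul_chart_domP dp dq dpq).
have [da aE] := diff_pair_left (chart j q) (chart i p) u.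
have E : chart k \o mul^~ q \o chart_inv i = mul_chart i j k \o (fun z => (z, chart j q)).
  by apply/funext => z; rewrite /mul_chart /= chartK.
rewrite E; split; first exact: (differentiable_comp da dF).
apply: esym; apply: etrans (congr1 (fun g => g u) (diff_comp da dF)) _.
by rewrite /= aE.
Qed.

Lemma chart_diff_mull a p : chart_diff G (mul a) p.
Proof.
split=> [|i j di dj]; last first.
  by have [] := diff_mul_chart_right 0 (chart_at_dom G a) di dj.
have := @continuous_comp _ _ _ (fun q : N => (a, q)) (fun pq : N * N => mul pq.1 pq.2) p.
apply; last exact: lg_mul_continuous.
by apply: cvg_pair; [exact: cvg_cst|exact: cvg_id].
Qed.

Lemma chart_diff_mulr b p : chart_diff G (mul^~ b) p.
Proof.
split=> [|i j di dj]; last first.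
  by have [] := diff_mul_chart_left 0 di (chart_at_dom G b) dj.
have := @continuous_comp _ _ _ (fun q : N => (q, b)) (fun pq : N * N => mul pq.1 pq.2) p.
apply; last exact: lg_mul_continuous.
by apply: cvg_pair; [exact: cvg_id|exact: cvg_cst].
Qed.

(** * Left- and right-invariant fields and their brackets *)

Definition linv_field (v : 'rV[R]_n) (p : N) : 'rV[R]_n := tangent_map G (mul p) 1 v.
Definition rinv_field (w : 'rV[R]_n) (p : N) : 'rV[R]_n := tangent_map G (mul^~ p) 1 w.

Lemma linv_field1 v : linv_field v 1 = v.
Proof.
rewrite /linv_field (_ : mul 1 = id) ?tangent_map_id //.
by apply/funext => p; rewrite lg_mul1.
Qed.

Lemma linv_fieldM v a p : linv_field v (mul a p) = tangent_map G (mul a) p (linv_field v p).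
Proof.
rewrite /linv_field (_ : mul (mul a p) = mul a \o mul p); last first.
  by apply/funext => q; rewrite /= lg_mulA.
rewrite tangent_map_comp ?lg_mulr1 //; exact: chart_diff_mull.
Qed.

Lemma rinv_fieldM w p b : rinv_field w (mul p b) = tangent_map G (mul^~ b) p (rinv_field w p).
Proof.
rewrite /rinv_field (_ : mul^~ (mul p b) = mul^~ b \o mul^~ p); last first.
  by apply/funext => q; rewrite /= lg_mulA.
rewrite tangent_map_comp ?lg_mul1 //; exact: chart_diff_mulr.
Qed.

Lemma rinv_field1 w : rinv_field w 1 = w.
Proof.
rewrite /rinv_field (_ : mul^~ 1 = id) ?tangent_map_id //.
by apply/funext => p; rewrite lg_mulr1.
Qed.

Lemma linv_field_related v i j k a c : dom i a -> dom j c -> dom k (mul a c) ->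
  to_chart k (mul a c) (linv_field v (mul a c))
  = 'd (mul_chart i j k) (chart i a, chart j c) (0, to_chart j c (linv_field v c)).
Proof.
move=> da dc dac; rewrite linv_fieldM (to_chart_tangent_map _ (chart_diff_mull a c) dc dac).
by have [_ ->] := diff_mul_chart_right (to_chart j c (linv_field v c)) da dc dac.
Qed.

Lemma rinv_field_related w i j k a c : dom i a -> dom j c -> dom k (mul a c) ->
  to_chart k (mul a c) (rinv_field w (mul a c))
  = 'd (mul_chart i j k) (chart i a, chart j c) (to_chart i a (rinv_field w a), 0).
Proof.
move=> da dc dac; rewrite rinv_fieldM (to_chart_tangent_map _ (chart_diff_mulr c a) da dac).
by have [_ ->] := diff_mul_chart_left (to_chart i a (rinv_field w a)) da dc dac.
Qed.

(** In a chart the field is the derivative of the multiplication in the fixed direction [(0, v)],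
    restricted to the slice where the second factor is the identity. *)
Lemma linv_field_smooth v : smooth_vfield G (linv_field v).
Proof.
move=> i k; have oi := @img_open _ _ _ _ i; have d1 := chart_at_dom G 1.
pose F := mul_chart i (chart_at 1) i.
have oU := @open_mul_chart_dom i (chart_at 1) i.
have sF := smooth_on_derive (0, v) (@mul_chart_smooth i (chart_at 1) i).
have := Ck_on_precomp oU (fun x => (diff_pair_left (pt_coord 1) x 0).1)
  (fun x u => (diff_pair_left (pt_coord 1) x u).2) (sF k).
move=> C; have sub : img i `<=` (fun z => (z, pt_coord 1)) @^-1` mul_chart_dom i (chart_at 1) i.
  move=> y iy /=; rewrite -(chart_invK iy); apply: mul_chart_domP => //.
    exact: dom_chart_inv.
  by rewrite lg_mulr1; exact: dom_chart_inv.
apply: (Ck_on_ext oi _ (Ck_on_sub sub C)) => y iy /=.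
have dq := dom_chart_inv iy; rewrite deriveE; last exact: (mul_chart_diff (sub _ iy)).
have dq1 : dom i (mul (chart_inv i y) 1) by rewrite lg_mulr1.
have := linv_field_related v dq d1 dq1.
rewrite linv_field1 to_chart_at lg_mulr1 chart_invK // => <-.
Qed.

Lemma rinv_field_smooth w : smooth_vfield G (rinv_field w).
Proof.
move=> i k; have oi := @img_open _ _ _ _ i; have d1 := chart_at_dom G 1.
have oU := @open_mul_chart_dom (chart_at 1) i i.
have sF := smooth_on_derive (w, 0) (@mul_chart_smooth (chart_at 1) i i).
have := Ck_on_precomp oU (fun x => (diff_pair_right (pt_coord 1) x 0).1)
  (fun x u => (diff_pair_right (pt_coord 1) x u).2) (sF k).
move=> C; have sub : img i `<=` (fun z => (pt_coord 1, z)) @^-1` mul_chart_dom (chart_at 1) i i.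
  move=> y iy /=; rewrite -(chart_invK iy); apply: mul_chart_domP => //.
    exact: dom_chart_inv.
  by rewrite lg_mul1; exact: dom_chart_inv.
apply: (Ck_on_ext oi _ (Ck_on_sub sub C)) => y iy /=.
have dq := dom_chart_inv iy; rewrite deriveE; last exact: (mul_chart_diff (sub _ iy)).
have dq1 : dom i (mul 1 (chart_inv i y)) by rewrite lg_mul1.
have := rinv_field_related w d1 dq dq1.
rewrite rinv_field1 to_chart_at lg_mul1 chart_invK // => <-.
Qed.

Lemma linv_field_left_invariant v : left_invariant_vfield G (linv_field v).
Proof. by split; [exact: linv_field_smooth|move=> a p; exact: linv_fieldM]. Qed.

(* Multiplication N x N -> N relates (0, X) to X for X left-invariant, and (Y, 0)
   to Y for Y right-invariant; both brackets below follow at the point (p, 1). *)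
Section Bracket.
Variable p : N.
Let i := chart_at p.
Let i1 := chart_at 1.
Let F := mul_chart i i1 i.
Let U := mul_chart_dom i i1 i.
Let x0 := (pt_coord p, pt_coord 1).

Let dp : dom i p := chart_at_dom G p.
Let d1 : dom i1 1 := chart_at_dom G 1.
Let dp1 : dom i (mul p 1).
Proof. by rewrite lg_mulr1. Qed.

Let Ux0 : U x0 := mul_chart_domP dp d1 dp1.

Let Fx0 : F x0 = pt_coord p.
Proof. by rewrite /F /mul_chart /= !chartK // lg_mulr1. Qed.

Let UP xy : U xy -> exists a c,
  [/\ xy = (chart i a, chart i1 c), dom i a, dom i1 c & dom i (mul a c)].
Proof. by move=> [[a c] /= [da [dc dac]] <-]; exists a, c. Qed.

(** Brings [(0, u)] into the form, coefficients times constant vectors, that [related_bracket]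
    expects. *)
Let sumR (u : 'rV[R]_n) : \sum_k u 0 k *: ((0, delta_mx 0 k) : 'rV[R]_n * 'rV[R]_n) = (0, u).
Proof.
rewrite [in RHS](row_sum_delta u).
apply: (big_ind2 (fun (a : 'rV[R]_n * 'rV[R]_n) b => a = (0, b))) => //.
  by move=> a b c d -> ->; congr (_, _); rewrite addr0.
by move=> k _; congr (_, _); rewrite scaler0.
Qed.

Let sumL (u : 'rV[R]_n) : \sum_k u 0 k *: ((delta_mx 0 k, 0) : 'rV[R]_n * 'rV[R]_n) = (u, 0).
Proof.
rewrite [in RHS](row_sum_delta u).
apply: (big_ind2 (fun (a : 'rV[R]_n * 'rV[R]_n) b => a = (b, 0))) => //.
  by move=> a b c d -> ->; congr (_, _); rewrite addr0.
by move=> k _; congr (_, _); rewrite scaler0.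
Qed.

Let relL v xy : U xy -> vfield_coord (linv_field v) i (F xy)
  = 'd F xy (\sum_k vfield_coord (linv_field v) i1 xy.2 0 k *: (0, delta_mx 0 k)).
Proof.
move=> /UP[a [c [-> da dc dac]]]; rewrite sumR /= /vfield_coord /F /mul_chart /= !chartK //.
exact: linv_field_related.
Qed.

Let relR w xy : U xy -> vfield_coord (rinv_field w) i (F xy)
  = 'd F xy (\sum_k vfield_coord (rinv_field w) i xy.1 0 k *: (delta_mx 0 k, 0)).
Proof.
move=> /UP[a [c [-> da dc dac]]]; rewrite sumL /= /vfield_coord /F /mul_chart /= !chartK //.
exact: rinv_field_related.
Qed.

Let dV X q : smooth_vfield G X ->
  differentiable (vfield_coord X (chart_at q)) (pt_coord q).
Proof. exact: smooth_vfield_pt. Qed.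

Let coordR (Y : 'rV[R]_n -> 'rV[R]_n) (k : 'I_n) s t : differentiable Y (pt_coord 1) ->
  differentiable (fun xy : 'rV[R]_n * 'rV[R]_n => Y xy.2 0 k) x0 /\
  'd (fun xy : 'rV[R]_n * 'rV[R]_n => Y xy.2 0 k) x0 (s, t) = ('d Y (pt_coord 1) t) 0 k.
Proof.
move=> dY; have [dc cE] := diff_coord_comp t k dY.
by have [D ->] := diff_comp_snd (pt_coord p) s t dc.
Qed.

Let coordL (Y : 'rV[R]_n -> 'rV[R]_n) (k : 'I_n) s t : differentiable Y (pt_coord p) ->
  differentiable (fun xy : 'rV[R]_n * 'rV[R]_n => Y xy.1 0 k) x0 /\
  'd (fun xy : 'rV[R]_n * 'rV[R]_n => Y xy.1 0 k) x0 (s, t) = ('d Y (pt_coord p) s) 0 k.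
Proof.
move=> dY; have [dc cE] := diff_coord_comp s k dY.
by have [D ->] := diff_comp_fst (pt_coord 1) s t dc.
Qed.

Let diff_mull u : 'd F x0 (0, u) = linv_field u p.
Proof.
have [_ ->] := diff_mul_chart_right u dp d1 dp1.
by rewrite /linv_field /tangent_map /i -{1}(lg_mulr1 p).
Qed.

Lemma lie_bracket_linv_pt v w :
  lie_bracket G (linv_field v) (linv_field w) p
  = linv_field (lie_bracket G (linv_field v) (linv_field w) 1) p.
Proof.
have dY u : differentiable (vfield_coord (linv_field u) i) (F x0).
  by rewrite Fx0; exact: dV (linv_field_smooth u).
have dY1 u := @dV _ 1 (linv_field_smooth u).
have da u (k : 'I_n) := (@coordR (vfield_coord (linv_field u) i1) k 0 0 (dY1 u)).1.
have := related_bracket (@open_mul_chart_dom i i1 i) Ux0 (@mul_chart_smooth i i1 i)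
  (da v) (da w) (dY v) (dY w) (relL v) (relL w).
rewrite -/F Fx0 !vfield_coord_pt -/(lie_bracket G _ _ p) => ->.
rewrite -diff_mull !sumR; congr ('d F x0 _).
under eq_bigr => k _ do rewrite (coordR k _ _ (dY1 w)).2.
under [X in _ - X]eq_bigr => k _ do rewrite (coordR k _ _ (dY1 v)).2.
rewrite !sumR; exact: (congr2 pair (subr0 0) erefl).
Qed.

Lemma lie_bracket_rinv_linv w v :
  lie_bracket G (rinv_field w) (linv_field v) p = 0.
Proof.
have dY : differentiable (vfield_coord (linv_field v) i) (F x0).
  by rewrite Fx0; exact: dV (linv_field_smooth v).
have dZ : differentiable (vfield_coord (rinv_field w) i) (F x0).
  by rewrite Fx0; exact: dV (rinv_field_smooth w).
have dY1 := @dV _ 1 (linv_field_smooth v).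
have dZ1 := @dV _ p (rinv_field_smooth w).
have da (k : 'I_n) := (@coordR (vfield_coord (linv_field v) i1) k 0 0 dY1).1.
have db (k : 'I_n) := (@coordL (vfield_coord (rinv_field w) i) k 0 0 dZ1).1.
have := related_bracket (@open_mul_chart_dom i i1 i) Ux0 (@mul_chart_smooth i i1 i)
  db da dZ dY (relR w) (relL v).
rewrite -/F Fx0 !vfield_coord_pt -/(lie_bracket G _ _ p) => ->.
rewrite sumR sumL.
(* The coefficients of each field depend on one factor and are differentiated along the other, so
   both sums vanish. *)
under eq_bigr => k _ do rewrite (coordR k _ _ dY1).2 linear0 mxE scale0r.
under [X in _ - X]eq_bigr => k _ do rewrite (coordL k _ _ dZ1).2 linear0 mxE scale0r.
by rewrite !sumr_const !mul0rn subr0 linear0.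
Qed.

End Bracket.

End LieGroup.

(** * The Levi-Civita connection in an orthonormal frame *)

Lemma mul_tr_entry (R : comPzRingType) m n p (X : 'M[R]_(m, n)) (Y : 'M[R]_(p, n)) i j :
  (X *m Y^T) i j = (row i X *m (row j Y)^T) 0 0.
Proof. by rewrite !mxE; apply: eq_bigr => a _; rewrite !mxE. Qed.

Section LeviCivita.
Context {R : realType} {n : nat} {M : topologicalType}.
Variable A : smooth_manifold R n M.
Variables (g : M -> 'M[R]_n) (nabla : (M -> 'rV[R]_n) -> (M -> 'rV[R]_n) -> M -> 'rV[R]_n).
Hypothesis hnabla : levi_civita A g nabla.
Implicit Types (X Y : M -> 'rV[R]_n).

Let sum_rcons (I : Type) (r : seq I) i (F : I -> M -> 'rV[R]_n) :
  (fun q => \sum_(j <- i :: r) F j q) = (fun q => F i q + \sum_(j <- r) F j q).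
Proof. by apply/funext => q; rewrite big_cons. Qed.

Lemma nabla_suml (I : Type) (r : seq I) (f : I -> M -> R) (X : I -> M -> 'rV[R]_n) Y p :
  (forall i, smooth_fun A (f i)) -> (forall i, smooth_vfield A (X i)) ->
  smooth_vfield A Y ->
  nabla (fun q => \sum_(i <- r) f i q *: X i q) Y p
  = \sum_(i <- r) f i p *: nabla (X i) Y p.
Proof.
move=> sf sX sY; have [_ [addX [scalX _]]] := hnabla.
elim: r => [|i r IHr].
  (* The connection axioms do not mention the zero field, so the empty sum is presented as the zero
     function times [Y]. *)
  rewrite big_nil (_ : (fun _ => _) = fun q => (fun=> 0 : R) q *: Y q); last first.
    by apply/funext => q; rewrite big_nil scale0r.
  by rewrite scalX ?scale0r //; exact: smooth_fun_cst.
rewrite sum_rcons addX //; last 2 first.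
- exact: smooth_vfieldZ.
- by apply: smooth_vfield_sum => j; exact: smooth_vfieldZ.
by rewrite big_cons IHr scalX.
Qed.

Lemma nabla_sumr (I : Type) (r : seq I) (f : I -> M -> R) (Y : I -> M -> 'rV[R]_n) X p :
  (forall i, smooth_fun A (f i)) -> (forall i, smooth_vfield A (Y i)) ->
  smooth_vfield A X ->
  nabla X (fun q => \sum_(i <- r) f i q *: Y i q) p
  = \sum_(i <- r) (dfun A (f i) p (X p) *: Y i p + f i p *: nabla X (Y i) p).
Proof.
move=> sf sY sX; have [_ [_ [_ [addY [leib _]]]]] := hnabla.
elim: r => [|i r IHr].
  rewrite big_nil (_ : (fun _ => _) = fun q => (fun=> 0 : R) q *: X q); last first.
    by apply/funext => q; rewrite big_nil scale0r.
  by rewrite leib ?dfun_cst ?scale0r ?addr0 //; exact: smooth_fun_cst.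
rewrite sum_rcons addY //; last 2 first.
- exact: smooth_vfieldZ.
- by apply: smooth_vfield_sum => j; exact: smooth_vfieldZ.
by rewrite big_cons IHr leib.
Qed.

Lemma parallel_metric_scaled l : sym_tensor_field A g ->
  parallel_tensor A nabla (fun p => l *: g p).
Proof.
have tE p u v : tensor_app (fun p => l *: g p) p u v = l * tensor_app g p u v.
  by rewrite /tensor_app -scalemxAr -scalemxAl mxE.
move=> [sg symg]; split; first split.
- move=> i u v k; have oi := @img_open _ _ _ _ i.
  apply: (Ck_on_ext oi _ (Ck_onM oi (Ck_on_cst k _ l) (sg i u v k))) => y _ /=.
  by rewrite tE.
- by move=> p; rewrite linearZ /= symg.
move=> X Y Z sX sY sZ p; rewrite /cov_tensor !tE.
have -> : (fun q => tensor_app (fun p0 => l *: g p0) q (Y q) (Z q))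
   = (fun q => (fun=> l) q * tensor_app g q (Y q) (Z q)) by apply/funext => q; rewrite tE.
have [_ [_ [_ [_ [_ [_ met]]]]]] := hnabla.
rewrite dfunM; [|exact: smooth_fun_cst|exact: smooth_tensor_app].
rewrite dfun_cst mulr0 addr0 met //; ring.
Qed.

Section Frame.
Variable E : 'I_n -> M -> 'rV[R]_n.
Hypothesis sE : forall i, smooth_vfield A (E i).
Hypothesis gE : forall i j p, tensor_app g p (E i p) (E j p) = (i == j)%:R.
Hypothesis hg : sym_tensor_field A g.
Variable J : 'I_n -> 'M[R]_n.
Hypothesis brE : forall i j p, lie_bracket A (E i) (E j) p = \sum_k J k i j *: E k p.

Definition frame_mx p : 'M[R]_n := \matrix_i E i p.

Let frame_orth p : frame_mx p *m g p *m (frame_mx p)^T = 1%:M.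
Proof.
apply/matrixP => i j; rewrite [RHS]mxE -(gE i j p) /tensor_app.
have Ei k : E k p = row k (frame_mx p) by rewrite rowK.
by rewrite !Ei -row_mul -mul_tr_entry.
Qed.

Definition frame_coord X k p := tensor_app g p (X p) (E k p).

Lemma frame_sumE (u : 'rV[R]_n) p : \sum_k u 0 k *: E k p = u *m frame_mx p.
Proof. by rewrite mulmx_sum_row; apply: eq_bigr => k _; rewrite rowK. Qed.

Lemma frame_matrix_inj p (S T : 'M[R]_n) :
  frame_mx p *m S *m (frame_mx p)^T = frame_mx p *m T *m (frame_mx p)^T -> S = T.
Proof.
have := frame_orth p; rewrite -mulmxA => o1; have [uf _] := mulmx1_unit o1.
have ut : (frame_mx p)^T \in unitmx by rewrite unitmx_tr.
by move=> /(can_inj (mulmxK ut))/(can_inj (mulKmx uf)).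
Qed.

Lemma frame_expansion u p : u = \sum_k tensor_app g p u (E k p) *: E k p.
Proof.
have -> : \sum_k tensor_app g p u (E k p) *: E k p
    = (u *m g p *m (frame_mx p)^T) *m frame_mx p.
  rewrite -frame_sumE; apply: eq_bigr => k _; congr (_ *: _).
  by rewrite mul_tr_entry rowK row_id.
have := frame_orth p; rewrite -mulmxA => /mulmx1C o1.
by rewrite -(mulmxA u) -(mulmxA u) o1 mulmx1.
Qed.

Lemma frame_coord_smooth X k : smooth_vfield A X -> smooth_fun A (frame_coord X k).
Proof. by move=> sX; apply: smooth_tensor_app => //; exact: hg.1. Qed.

Lemma frame_coordE X : X = fun p => \sum_k frame_coord X k p *: E k p.
Proof. by apply/funext => p; exact: frame_expansion. Qed.

Lemma frame_coord_sum (u : 'I_n -> M -> R) j p :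
  tensor_app g p (\sum_k u k p *: E k p) (E j p) = u j p.
Proof.
have := tensor_app_sum g p (index_enum 'I_n) [:: j] (fun k => u k p) (fun=> 1)
  (fun k => E k p) (fun j => E j p).
rewrite big_seq1 scale1r => ->; rewrite (bigD1 j) //= big_seq1 gE eqxx !mulr1.
by rewrite big1 ?addr0 // => k /negPf kj; rewrite big_seq1 gE kj mulr0.
Qed.

(** Connection coefficients of the frame. They are eliminated in favour of [J] by the skewness in
    the last two indices (metric compatibility) and by the torsion relation. *)
Let Gamma i k j p := tensor_app g p (nabla (E i) (E k) p) (E j p).

Let tensor_sym p u v : tensor_app g p u v = tensor_app g p v u.
Proof.
have E1 : v *m g p *m u^T = (u *m g p *m v^T)^T.
  by rewrite !trmx_mul trmxK hg.2 mulmxA.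
by rewrite /tensor_app E1 [RHS]mxE.
Qed.

Let Gamma_skew i k j p : Gamma i j k p = - Gamma i k j p.
Proof.
have [_ [_ [_ [_ [_ [_ met]]]]]] := hnabla.
have := met (E i) (E k) (E j) p (sE i) (sE k) (sE j).
rewrite (_ : (fun q => _) = fun=> (k == j)%:R); last by apply/funext => q; rewrite gE.
rewrite dfun_cst [X in _ + X]tensor_sym => /esym/eqP; rewrite addrC addr_eq0.
by move=> /eqP.
Qed.

Let tensor_appDl p u u' v : tensor_app g p (u + u') v = tensor_app g p u v + tensor_app g p u' v.
Proof. by rewrite /tensor_app !mulmxDl !mxE. Qed.

Let tensor_addl p u u' v : tensor_app g p (u - u') v = tensor_app g p u v - tensor_app g p u' v.
Proof. by rewrite /tensor_app !mulmxBl !mxE. Qed.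

Let Gamma_torsion i k j p : Gamma i k j p = Gamma k i j p + J j i k.
Proof.
have [_ [_ [_ [_ [_ [tors _]]]]]] := hnabla.
have := congr1 (fun v => tensor_app g p v (E j p)) (tors _ _ p (sE i) (sE k)).
rewrite brE tensor_addl (frame_coord_sum (fun a _ => J a i k)) => <-.
by rewrite addrC subrK.
Qed.

(** The Leibniz rule for the bracket, obtained from the rules for [nabla] through vanishing
    torsion. *)
Lemma lie_bracket_comb (u : 'I_n -> M -> R) i p : (forall k, smooth_fun A (u k)) ->
  lie_bracket A (fun q => \sum_k u k q *: E k q) (E i) p
  = \sum_k (\sum_l u l p * J k l i - dfun A (u k) p (E i p)) *: E k p.
Proof.
move=> su; have [_ [_ [_ [_ [_ [tors _]]]]]] := hnabla.
have sX : smooth_vfield A (fun q => \sum_k u k q *: E k q).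
  by apply: smooth_vfield_sum => k; exact: smooth_vfieldZ.
rewrite -(tors _ _ p sX (sE i)) nabla_suml // nabla_sumr // -sumrB.
under [RHS]eq_bigr => k _ do rewrite scalerBl scaler_suml.
rewrite [RHS]sumrB [in RHS]exchange_big /= -[RHS]sumrB; apply: eq_bigr => k _.
rewrite opprD addrA addrAC -scalerBr (tors _ _ p (sE k) (sE i)) brE.
by rewrite scaler_sumr; congr (_ - _); apply: eq_bigr => l _; rewrite scalerA.
Qed.

Lemma killing_of_components (u : 'I_n -> M -> R) : (forall k, smooth_fun A (u k)) ->
  (forall i j p, dfun A (u j) p (E i p) + dfun A (u i) p (E j p)
     + \sum_k u k p * (J j i k + J i j k) = 0) ->
  killing_vfield A g (fun p => \sum_k u k p *: E k p).
Proof.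
move=> su ku; set xi := fun p => _.
have [_ [_ [_ [_ [_ [tors met]]]]]] := hnabla.
have sxi : smooth_vfield A xi.
  by apply: smooth_vfield_sum => k; exact: smooth_vfieldZ.
split=> // X Y sX sY p.
rewrite (met xi X Y p sxi sX sY) -(tors _ _ p sxi sX) -(tors _ _ p sxi sY).
rewrite tensor_addl [tensor_app g p (X p) (_ - _)]tensor_sym tensor_addl.
rewrite [tensor_app g p (X p) _]tensor_sym.
(* By metric compatibility and vanishing torsion, the Killing equation says that the covariant
   derivative of [xi] is skew; this is then checked on pairs of frame vectors. *)
suff K : tensor_app g p (nabla X xi p) (Y p) + tensor_app g p (nabla Y xi p) (X p) = 0.
  rewrite addrACA -opprD K subr0 //.
have nE Z : smooth_vfield A Z ->
    nabla Z xi p = \sum_i frame_coord Z i p *: nabla (E i) xi p.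
  move=> sZ; rewrite [in LHS](frame_coordE Z) nabla_suml //.
  by move=> i; exact: frame_coord_smooth.
rewrite (nE X sX) (nE Y sY).
have XE := frame_expansion (X p) p; have YE := frame_expansion (Y p) p.
rewrite [in X in X + _]YE [in X in _ + X]XE !tensor_app_sum.
rewrite [X in _ + X]exchange_big -big_split big1 // => i _.
rewrite -big_split big1 // => j _ /=; rewrite /frame_coord.
suff K : tensor_app g p (nabla (E i) xi p) (E j p)
       + tensor_app g p (nabla (E j) xi p) (E i p) = 0.
  rewrite [X in _ + X * _]mulrC -mulrDr K mulr0 //.
have dE a b : tensor_app g p (nabla (E a) xi p) (E b p)
    = dfun A (u b) p (E a p) + \sum_k u k p * Gamma a k b p.
  rewrite nabla_sumr // big_split /= tensor_appDl.
  rewrite (frame_coord_sum (fun k q => dfun A (u k) q (E a q))); congr (_ + _).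
  have := tensor_app_sum g p (index_enum 'I_n) [:: b] (fun k => u k p) (fun=> 1)
    (fun k => nabla (E a) (E k) p) (fun b => E b p).
  rewrite big_seq1 scale1r => ->; apply: eq_bigr => k _.
  by rewrite big_seq1 mulr1.
rewrite !dE addrACA -big_split -[RHS](ku i j p); congr (_ + _).
apply: eq_bigr => k _ /=; rewrite -mulrDr; congr (_ * _).
(* The torsion relation moves [k] to the first index; the two coefficients are then opposite, and
   only structure constants remain. *)
rewrite (Gamma_torsion i k j) (Gamma_torsion j k i) (Gamma_skew k i j).
ring.
Qed.

(** For a combination X of the frame with constant coefficients, S(X, X) is constant, so the Killing
    equation reduces to S(nabla_X X, X) = 0, where nabla_X X has components minus those of the sum
    of x_j (x J j). *)
Lemma killing_tensor_form (S : M -> 'M[R]_n) (s : 'M[R]_n) (p : M) (x : 'rV[R]_n) :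
  (forall i j p, tensor_app S p (E i p) (E j p) = s i j) ->
  killing_tensor A nabla S -> \sum_k x 0 k *: (x *m J k *m s *m x^T) = 0.
Proof.
move=> sS [[_ symS] kS].
pose X q := \sum_k x 0 k *: E k q.
have sc c : smooth_fun A (fun=> c) by exact: smooth_fun_cst.
have sX : smooth_vfield A X.
  by apply: smooth_vfield_sum => k; apply: (smooth_vfieldZ (f := fun=> x 0 k)).
have Scomb (a b : 'I_n -> R) q : tensor_app S q (\sum_k a k *: E k q) (\sum_k b k *: E k q)
    = \sum_i \sum_j a i * b j * s i j.
  by rewrite tensor_app_sum; apply: eq_bigr => i _; apply: eq_bigr => j _; rewrite sS.
have := kS X sX p; rewrite /cov_tensor.
rewrite (_ : (fun q => _) = fun=> \sum_i \sum_j x 0 i * x 0 j * s i j); last first.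
  by apply/funext => q; exact: Scomb.
rewrite dfun_cst sub0r.
pose y k := \sum_i \sum_j x 0 i * x 0 j * Gamma i j k p.
have nXX : nabla X X p = \sum_k y k *: E k p.
  rewrite [in LHS](nabla_suml _ _ _ sE sX) //.
  rewrite (frame_expansion (\sum_i _) p); apply: eq_bigr => k _; congr (_ *: _).
  rewrite /y; have := tensor_app_sum g p (index_enum 'I_n) [:: k] (fun i => x 0 i) (fun=> 1)
    (fun i => nabla (E i) X p) (fun k => E k p).
  rewrite big_seq1 scale1r => ->; apply: eq_bigr => i _; rewrite big_seq1 mulr1.
  rewrite (nabla_sumr _ _ _ sE (sE i)) //.
  under eq_bigr => j _ do rewrite dfun_cst scale0r add0r.
  have := tensor_app_sum g p (index_enum 'I_n) [:: k] (fun i => x 0 i) (fun=> 1)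
    (fun j => nabla (E i) (E j) p) (fun k => E k p).
  rewrite big_seq1 scale1r => ->; rewrite mulr_sumr; apply: eq_bigr => j _.
  by rewrite big_seq1 mulr1 mulrA.
have yE k : y k = - \sum_j x 0 j * (x *m J j) 0 k.
  (* A symmetric factor against coefficients skew in [i] and [j]; this removes the coefficient
     produced by the torsion relation. *)
  have z0 : \sum_i \sum_j x 0 i * x 0 j * Gamma k i j p = 0.
    set D := LHS; have DN : D = - D.
      rewrite {1}/D exchange_big -sumrN; apply: eq_bigr => i _ /=.
      rewrite -sumrN; apply: eq_bigr => j _.
      by rewrite [Gamma k j i p]Gamma_skew mulrN [x 0 j * _]mulrC.
    by move/eqP: DN; rewrite -addr_eq0 -mulr2n mulrn_eq0 => /eqP.
  have -> : \sum_j x 0 j * (x *m J j) 0 k = \sum_i \sum_j x 0 i * x 0 j * J j i k.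
    rewrite exchange_big; apply: eq_bigr => j _; rewrite mxE mulr_sumr.
    by apply: eq_bigr => i _; ring.
  rewrite -[X in - X]add0r -[X in - (X + _)]z0 -big_split -sumrN; apply: eq_bigr => i _ /=.
  rewrite -big_split -sumrN; apply: eq_bigr => j _ /=.
  rewrite (Gamma_skew i k j) (Gamma_torsion i k j); ring.
have Ssym u v : tensor_app S p u v = tensor_app S p v u.
  have E1 : v *m S p *m u^T = (u *m S p *m v^T)^T.
    by rewrite !trmx_mul trmxK symS mulmxA.
  by rewrite /tensor_app E1 [RHS]mxE.
rewrite [X in _ - X]Ssym -opprD => /eqP; rewrite oppr_eq0 -mulr2n mulrn_eq0 => /eqP.
rewrite nXX Scomb => S0; apply/matrixP => a b; rewrite !ord1 [RHS]mxE -[RHS]oppr0 -S0.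
rewrite summxE; transitivity (\sum_j x 0 j * \sum_k \sum_l (x *m J j) 0 k * x 0 l * s k l).
  apply: eq_bigr => j _; rewrite mxE; congr (_ * _).
  rewrite mxE exchange_big /=; apply: eq_bigr => l _.
  rewrite [x^T _ _]mxE [(_ *m s) _ _]mxE mulr_suml; apply: eq_bigr => k _; ring.
under eq_bigr => j _ do rewrite mulr_sumr.
rewrite exchange_big -sumrN; apply: eq_bigr => k _ /=.
under eq_bigr => j _ do rewrite mulr_sumr.
rewrite exchange_big -sumrN; apply: eq_bigr => l _ /=.
rewrite yE !mulNr opprK !mulr_suml; apply: eq_bigr => j _; ring.
Qed.

End Frame.
End LeviCivita.

(** * Decomposition *)

Lemma dfun_sumr (R : realType) n (M : topologicalType) (A : smooth_manifold R n M)
    (f : M -> R) p (I : Type) (r : seq I) (a : I -> R) (v : I -> 'rV[R]_n) :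
  dfun A f p (\sum_(i <- r) a i *: v i) = \sum_(i <- r) a i * dfun A f p (v i).
Proof. by rewrite /dfun linear_sum; apply: eq_bigr => i _; rewrite linearZ. Qed.

(** * Left-invariant frames, structure constants and the functions f *)

Section LeftInvariantFrame.
Context {R : realType} {n : nat} {N : topologicalType}.
Variable G : lie_group R n N.
Notation mul := (lg_mul G).
Notation "1" := (lg_one G).

Lemma left_invariant_tensor_linv (T : N -> 'M[R]_n) v w p : left_invariant_tensor G T ->
  tensor_app T p (linv_field G v p) (linv_field G w p) = tensor_app T 1 v w.
Proof. by move=> hT; have := hT p 1 v w; rewrite {1}(lg_mulr1 G p). Qed.

Variables (g : N -> 'M[R]_n)
  (nabla : (N -> 'rV[R]_n) -> (N -> 'rV[R]_n) -> N -> 'rV[R]_n).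
Hypothesis hconn : connected [set: N].
Hypothesis hnil : two_step_nilpotent G.
Hypothesis hg : riemannian_metric G g.
Hypothesis hginv : left_invariant_tensor G g.
Hypothesis hnabla : levi_civita G g nabla.

Lemma orthonormal_left_invariant_frame : exists E : 'I_n -> N -> 'rV[R]_n,
  (forall i, exists v, E i = linv_field G v) /\
  (forall i j p, tensor_app g p (E i p) (E j p) = (i == j)%:R).
Proof.
have [B BK] : exists B : 'M[R]_n, B *m g 1 *m B^T = 1%:M.
  apply: posdef_orthonormal_basis; first exact: hg.1.2.
  by move=> v vn0; exact: hg.2.
exists (fun i => linv_field G (row i B)); split=> [i|i j p]; first by exists (row i B).
rewrite left_invariant_tensor_linv // /tensor_app -row_mul -mul_tr_entry BK.
by rewrite mxE.
Qed.

Section Frame.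
Variable E : 'I_n -> N -> 'rV[R]_n.
Hypothesis linvE : forall i, exists v, E i = linv_field G v.
Hypothesis gE : forall i j p, tensor_app g p (E i p) (E j p) = (i == j)%:R.

Let sE i : smooth_vfield G (E i).
Proof. by have [v ->] := linvE i; exact: linv_field_smooth. Qed.

Definition struct_mx k : 'M[R]_n :=
  \matrix_(i, j) tensor_app g 1 (lie_bracket G (E i) (E j) 1) (E k 1).
Let J := struct_mx.

Lemma tensor_app_frame T i j p : left_invariant_tensor G T ->
  tensor_app T p (E i p) (E j p) = tensor_app T 1 (E i 1) (E j 1).
Proof.
have [[v ->] [w ->]] := (linvE i, linvE j) => hT.
by rewrite !left_invariant_tensor_linv.
Qed.

Lemma lie_bracket_frame i j p : lie_bracket G (E i) (E j) p = \sum_k J k i j *: E k p.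
Proof.
have E1 : lie_bracket G (E i) (E j) p = linv_field G (lie_bracket G (E i) (E j) 1) p.
  by have [[v ->] [w ->]] := (linvE i, linvE j); exact: lie_bracket_linv_pt.
rewrite E1 [LHS](frame_expansion gE _ p); apply: eq_bigr => k _; congr (_ *: _).
rewrite mxE; have [v ->] := linvE k.
by rewrite left_invariant_tensor_linv // linv_field1.
Qed.

Lemma struct_mx_skew k : (J k)^T = - J k.
Proof.
apply/matrixP => i j; rewrite !mxE /lie_bracket -[X in tensor_app _ _ X]opprB.
by rewrite /tensor_app !mulNmx mxE.
Qed.

Lemma struct_mx_nil i j k m : \sum_l J l i j * J k l m = 0.
Proof.
have linv a : left_invariant_vfield G (E a).
  by have [v ->] := linvE a; exact: linv_field_left_invariant.
have := hnil.2 (E i) (E j) (E m) (linv i) (linv j) (linv m) 1.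
have -> : lie_bracket G (E i) (E j) = fun q => \sum_l (fun=> J l i j) q *: E l q.
  by apply/funext => q; exact: lie_bracket_frame.
rewrite (lie_bracket_comb hnabla sE lie_bracket_frame); last first.
  by move=> l; exact: smooth_fun_cst.
move=> /(congr1 (fun v => tensor_app g 1 v (E k 1))).
rewrite (frame_coord_sum gE (fun k q =>
  \sum_l J l i j * J k l m - dfun G (fun=> J k i j) q (E m q))).
by rewrite dfun_cst subr0 => ->; rewrite /tensor_app !mul0mx mxE.
Qed.

(* The witnesses are the components of the right-invariant field through [E a 1].
   They are primitives of left-invariant one-forms spanning the annihilator of
   the centre. *)
Lemma primitives : exists h : 'I_n -> 'I_n -> N -> R,
  (forall a l, smooth_fun G (h a l)) /\
  forall a l i p, dfun G (h a l) p (E i p) = J l a i.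
Proof.
pose h a l := frame_coord g E (rinv_field G (E a 1)) l.
have sh a l : smooth_fun G (h a l).
  by apply: (frame_coord_smooth sE hg.1); exact: rinv_field_smooth.
exists h; split=> // a l i p.
(* Left- and right-invariant fields commute; expanded in the frame, this is a linear differential
   system for the components [h]. *)
have dh k j q : dfun G (h a k) q (E j q) = \sum_m h a m q * J k m j.
  have [v Ev] := linvE j.
  have := lie_bracket_rinv_linv G q (E a 1) v; rewrite -Ev.
  rewrite [X in lie_bracket _ X](frame_coordE gE (rinv_field G (E a 1))).
  rewrite (lie_bracket_comb hnabla sE lie_bracket_frame); last by move=> b; exact: sh.
  move=> /(congr1 (fun v => tensor_app g q v (E k q))).
  rewrite (frame_coord_sum gE (fun k q => \sum_l h a l q * J k l j - dfun G (h a k) q (E j q))).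
  rewrite {1}/tensor_app !mul0mx mxE => /eqP.
  by rewrite subr_eq0 => /eqP ->.
(* The derivative of [h a l] is itself constant: deriving it once more produces double brackets,
   which vanish, and at the identity [h a m] is 1 if [m] is [a] and 0 otherwise. *)
rewrite dh; pose f q := \sum_m h a m q * J l m i.
have sf : smooth_fun G f.
  by apply: smooth_fun_sum => m; apply: smooth_funM => //; exact: smooth_fun_cst.
have df q v : dfun G f q v = 0.
  rewrite (frame_expansion gE v q) dfun_sumr big1 // => j _.
  rewrite dfun_sum => [|m]; last by apply: smooth_funM => //; exact: smooth_fun_cst.
  transitivity (tensor_app g q v (E j q) *
      \sum_b h a b q * \sum_m J m b j * J l m i).
    congr (_ * _); transitivity (\sum_m \sum_b h a b q * (J m b j * J l m i)).
      apply: eq_bigr => m _; rewrite dfunM //; last exact: smooth_fun_cst.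
      rewrite dfun_cst mulr0 add0r dh mulr_sumr; apply: eq_bigr => b _; ring.
    by rewrite exchange_big; apply: eq_bigr => b _; rewrite mulr_sumr.
  by rewrite big1 ?mulr0 // => b _; rewrite struct_mx_nil mulr0.
have -> : \sum_m h a m p * J l m i = f p by [].
rewrite (dfun0_cst hconn sf df p 1) /f (bigD1 a) //= big1 ?addr0.
  by rewrite /h /frame_coord rinv_field1 gE eqxx mul1r.
by move=> m /negPf ma; rewrite /h /frame_coord rinv_field1 gE eq_sym ma mul0r.
Qed.

Section Potential.
Variables (P : 'M[R]_n) (f : 'I_n -> N -> R).
Hypothesis symP : P^T = P.
Hypothesis sf : forall a, smooth_fun G (f a).
Hypothesis df : forall a i p, dfun G (f a) p (E i p) = P a i.
Let fv p := \row_a f a p.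

(** Transfers the matrix condition to the manifold: [P] is the Jacobian of f in the frame, and it is
    absorbed because it fixes the linear and quadratic coefficients. *)
Lemma quad_killing_vfield u : quad_killing J P u ->
  killing_vfield G g (fun p => \sum_j u (fv p) 0 j *: E j p).
Proof.
move=> [w [L [B [-> PL symB PB ku]]]].
have uE p j : quad_field w L B (fv p) 0 j = w 0 j + \sum_a f a p * L a j
    + 2^-1 * \sum_a \sum_b f a p * f b p * B j a b.
  rewrite mxE [X in X + _]mxE [X in _ + X]mxE; congr (_ + _ + _ * _).
    by rewrite mxE; apply: eq_bigr => a _; rewrite mxE.
  rewrite mxE exchange_big; apply: eq_bigr => b _; rewrite mxE mulr_suml.
  by apply: eq_bigr => a _; rewrite !mxE; ring.
have scst c : smooth_fun G (fun=> c) by exact: smooth_fun_cst.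
have sL j : smooth_fun G (fun p => \sum_a f a p * L a j).
  by apply: smooth_fun_sum => a; apply: smooth_funM.
have sB j a b : smooth_fun G (fun p => f a p * f b p * B j a b).
  by apply: smooth_funM => //; apply: smooth_funM.
have sBB j : smooth_fun G (fun p => \sum_a \sum_b f a p * f b p * B j a b).
  by apply: smooth_fun_sum => a; apply: smooth_fun_sum => b.
have su1 j : smooth_fun G (fun p => w 0 j + \sum_a f a p * L a j) by apply: smooth_funD.
have su2 j : smooth_fun G (fun p => 2^-1 * \sum_a \sum_b f a p * f b p * B j a b).
  exact: smooth_funM.
have uE' j : (fun p => quad_field w L B (fv p) 0 j) = fun p => w 0 j + \sum_a f a p * L a j
    + 2^-1 * \sum_a \sum_b f a p * f b p * B j a b.
  by apply/funext => p; exact: uE.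
have du i j p : dfun G (fun p => quad_field w L B (fv p) 0 j) p (E i p)
    = L i j + (fv p *m B j) 0 i.
  rewrite uE' dfunD // dfunD // dfun_cst add0r dfun_sum; last by move=> a; apply: smooth_funM.
  rewrite dfunM // dfun_cst mulr0 addr0 dfun_sum; last by move=> a; apply: smooth_fun_sum.
  congr (_ + _).
    have /matrixP/(_ i j) := PL; rewrite mxE => <-; apply: eq_bigr => a _.
    rewrite dfunM // dfun_cst mulr0 add0r df mulrC; congr (_ * _).
    by rewrite -[in LHS]symP mxE.
  have Bsym a b : B j a b = B j b a by rewrite -[in LHS](symB j) mxE.
  (* The derivatives of the two factors of the quadratic form contribute equally, by symmetry of
     [B j], which uses up the factor one half. *)
  have E1 : (fv p *m B j) 0 i = \sum_a \sum_b P a i * f b p * B j a b.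
    rewrite mxE exchange_big; apply: eq_bigr => b _.
    rewrite Bsym -[in LHS](PB j) !mxE mulr_sumr; apply: eq_bigr => a _.
    by rewrite -[in LHS]symP mxE; ring.
  have E2 : (fv p *m B j) 0 i = \sum_a \sum_b f a p * P b i * B j a b.
    rewrite E1 exchange_big; apply: eq_bigr => a _; apply: eq_bigr => b _.
    by rewrite Bsym; ring.
  have half (x y : R) : x + x = y -> 2^-1 * y = x by move=> <-; field.
  apply: half; rewrite {1}E1 E2 -big_split; apply: eq_bigr => a _ /=.
  rewrite dfun_sum // -big_split; apply: eq_bigr => b _ /=.
  rewrite dfunM //; last exact: smooth_funM.
  rewrite dfun_cst dfunM // !df; ring.
apply: (killing_of_components hnabla sE gE hg.1 lie_bracket_frame).
  by move=> j; rewrite uE'; apply: smooth_funD.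
move=> i j p; rewrite !du -[RHS](ku (fv p) i j).
have uJ a b : (quad_field w L B (fv p) *m J a) 0 b
    = - \sum_k quad_field w L B (fv p) 0 k * J a b k.
  rewrite [LHS]mxE -sumrN; apply: eq_bigr => k _.
  by have /matrixP/(_ k b) := struct_mx_skew a; rewrite !mxE => ->; rewrite mulrN opprK.
rewrite !uJ; under eq_bigr => k _ do rewrite mulrDr.
rewrite big_split /=; ring.
Qed.
End Potential.

End Frame.
End LeftInvariantFrame.

Theorem theorem5p13 (R : realType) (n : nat) (N : topologicalType)
  (G : lie_group R n N)
  (hconn : connected [set: N])
  (hsimply : loops_contractible R N)
  (hdim : (n <= 7)%N)
  (hnil : two_step_nilpotent G)
  (g : N -> 'M[R]_n)
  (hg : riemannian_metric G g)
  (hginv : left_invariant_tensor G g)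
  (nabla : (N -> 'rV[R]_n) -> (N -> 'rV[R]_n) -> N -> 'rV[R]_n)
  (hnabla : levi_civita G g nabla)
  (S : N -> 'M[R]_n)
  (hSinv : left_invariant_tensor G S)
  (hS : killing_tensor G nabla S) :
  decomposable G g nabla S.
Proof.
have [E [linvE gE]] := orthonormal_left_invariant_frame hg hginv.
have sE i : smooth_vfield G (E i).
  by have [v ->] := linvE i; exact: linv_field_smooth.
have brE := lie_bracket_frame hginv linvE gE.
have skJ := struct_mx_skew G g E.
have nilJ := struct_mx_nil hnil hginv hnabla linvE gE.
have [h [sh dh]] := primitives hconn hnil hg hginv hnabla linvE gE.
set J := struct_mx G g E in brE skJ nilJ dh.
pose s : 'M[R]_n := \matrix_(i, j) tensor_app S (lg_one G) (E i (lg_one G)) (E j (lg_one G)).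
have sS i j p : tensor_app S p (E i p) (E j p) = s i j.
  by rewrite (tensor_app_frame linvE) // mxE.
have symS : s^T = s.
  apply/matrixP => i j; rewrite mxE -!(sS _ _ (lg_one G)) /tensor_app.
  set u := E i _; set v := E j _; have -> : v *m S (lg_one G) *m u^T = (u *m S (lg_one G) *m v^T)^T.
    by rewrite !trmx_mul trmxK hS.1.2 mulmxA.
  by rewrite mxE.
have killS x := killing_tensor_form hnabla sE gE hg.1 brE (lg_one G) x sS hS.
have [P [X [l [symP PX [m [c [u [v [Ku Kv TE]]]]]]]]] :=
  killing_form_decomposition hdim skJ nilJ symS killS.
(* The derivatives of [h a k] are the entries of row [a] of [J k]; combining them with the
   coefficients [X] gives functions whose Jacobian in the frame is [P]. *)
pose f b p := \sum_k \sum_a X k b a * h a k p.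
have scst (z : R) : smooth_fun G (fun=> z) by exact: smooth_fun_cst.
have sXh b k a : smooth_fun G (fun p => X k b a * h a k p) by apply: smooth_funM.
have sf b : smooth_fun G (f b).
  by apply: smooth_fun_sum => k; apply: smooth_fun_sum => a.
have df b i p : dfun G (f b) p (E i p) = P b i.
  rewrite dfun_sum => [|k]; last by apply: smooth_fun_sum => a.
  rewrite PX summxE; apply: eq_bigr => k _; rewrite dfun_sum // mxE.
  by apply: eq_bigr => a _; rewrite dfunM // dfun_cst mulr0 addr0 dh.
pose fv p := \row_a f a p.
have Kvf w := quad_killing_vfield hg hginv hnabla linvE gE symP sf df (u := w).
exists (fun p => l *: g p), m, c, (fun k p => \sum_j u k (fv p) 0 j *: E j p),
  (fun k p => \sum_j v k (fv p) 0 j *: E j p).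
split; first exact: (parallel_metric_scaled hnabla l hg.1).
split; first by move=> k; exact: Kvf (Ku k).
split; first by move=> k; exact: Kvf (Kv k).
(* In the frame, the metric is the identity matrix and [S] is the constant matrix [s], so the claim
   becomes the matrix identity [TE] taken at f(p). *)
move=> p; apply: (frame_matrix_inj gE (p := p)).
set F := frame_mx E p.
have FT T : F *m T *m F^T = \matrix_(i, j) (E i p *m T *m (E j p)^T) 0 0.
  by apply/matrixP => i j; rewrite [RHS]mxE mul_tr_entry row_mul !rowK.
have Fg : F *m g p *m F^T = 1%:M.
  by rewrite FT; apply/matrixP => i j; rewrite mxE [RHS]mxE -(gE i j p).
have FS : F *m S p *m F^T = s.
  by rewrite FT; apply/matrixP => i j; rewrite mxE -(sS i j p).
rewrite FS mulmxDr mulmxDl -scalemxAr -scalemxAl Fg scalemx1.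
rewrite -[LHS](subrK l%:M) addrC (TE (fv p)); congr (_ + _).
rewrite mulmx_sumr mulmx_suml; apply: eq_bigr => k _.
rewrite -scalemxAr -scalemxAl; congr (_ *: _).
(* The frame being orthonormal, lowering the index by [g] leaves the frame components unchanged. *)
have flatE (w : N -> 'rV[R]_n) :
    (\sum_j w p 0 j *: E j p) *m (g p *m F^T) = w p.
  by rewrite (frame_sumE E) -[RHS]mulmx1 -Fg !mulmxA.
have trE (w : 'rV[R]_n) : F *m w^T = (w *m F^T)^T by rewrite trmx_mul trmxK.
rewrite /sym_product mulmxDr mulmxDl !mulmxA !trE -!mulmxA.
by rewrite (flatE (fun q => u k (fv q))) (flatE (fun q => v k (fv q))).
Qed.
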